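(* Let $n\ge1$ and let $x=(x_1,\dots,x_n)$, $y=(y_1,\dots,y_n)$ be indeterminates. Then \begin{align*} A^{(2)}_{\mathrm{VHP}}(4n+2;x,y;\zeta_4)&=2^{-2n^2}\prod_{i=1}^n x_i^{-2n}y_i^{-2n}\prod_{i,j=1}^n(x_i^2+y_j^2)(1+x_i^2y_j^2),\\ A^{(2)}_{\mathrm{VHP}}(4n+2;x,y;\zeta_6)&=3^{-n^2}\prod_{i=1}^n(y_i^2+1+y_i^{-2})\,\mathrm{Sp}_{4n}\big(\delta(n-1,n-1);x_1^2,\dots,x_n^2,y_1^2,\dots,y_n^2\big),\\ A^{(2)}_{\mathrm{VHP}}(4n+2;x,x;\zeta_8)&=2^{-n^2+n}\,\mathrm{GL}_{2n}\big(\delta^2(2n-2,2n-2);x_1^2,\dots,x_n^2,x_1^{-2},\dots,x_n^{-2}\big). \end{align*}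
   Context: $\sigma(t)=t-t^{-1}$, $\zeta_m=\exp(2\pi\sqrt{-1}/m)$. For parameters $a,b,c$ let $M_{\mathrm{UU}}(n;x,y;a,b,c)$ be the $n\times n$ matrix with entries $\dfrac{\sigma(b/y_j)\sigma(cx_i)}{\sigma(ax_i/y_j)}-\dfrac{\sigma(b/y_j)\sigma(c/x_i)}{\sigma(a/(x_iy_j))}-\dfrac{\sigma(by_j)\sigma(cx_i)}{\sigma(ax_iy_j)}+\dfrac{\sigma(by_j)\sigma(c/x_i)}{\sigma(ay_j/x_i)}$, let $F_{\mathrm V}(n;x,y;a)=\dfrac{\prod_{i,j=1}^n\sigma(ax_i/y_j)\sigma(ay_j/x_i)\sigma(ax_iy_j)\sigma(a/(x_iy_j))}{\prod_{1\le i<j\le n}\sigma(x_j/x_i)\sigma(y_i/y_j)\prod_{1\le i\le j\le n}\sigma(1/(x_ix_j))\sigma(y_iy_j)}$, and $A^{(2)}_{\mathrm{VHP}}(4n+2;x,y;a)=\sigma(a)^{-2n^2-n}F_{\mathrm V}(n;x,y;a)\,(-1)^n\det M_{\mathrm{UU}}(n;x,y;a,a,a^{-1})$; with $y=x$ for the last identity. Sequences: for $r\in\mathbb Z$, $\delta(r)$ is $(r,r-1,\dots)$ consisting of all $r-k\ge0$ and $\delta^2(r)=(r,r-2,\dots)$ of all $r-2k\ge0$ ($k\in\mathbb Z_{\ge0}$), empty if $r<0$; $\delta(r,s)$, $\delta^2(r,s)$ arrange the entries of the two sequences together in non-increasing order. As the index of a character in $N$ variables, such a sequence is replaced by its first $N$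 entries (padded with zeros if shorter). For a partition $\lambda$ of length $\le N$ and $z=(z_1,\dots,z_N)$: $\mathrm{GL}_N(\lambda;z)=\det(z_i^{\lambda_j+N-j})/\det(z_i^{N-j})$; $\mathrm{Sp}_{2N}(\lambda;z)=\det\big(z_i^{\lambda_j+N-j+1}-z_i^{-(\lambda_j+N-j+1)}\big)/\det\big(z_i^{N-j+1}-z_i^{-(N-j+1)}\big)$ (symmetric Laurent polynomials). *)

(* Defs.v *)
From HB Require Import structures.
From mathcomp Require Import all_boot all_order all_algebra.
From mathcomp Require Import reals trigo.
From mathcomp.real_closed Require Import complex.
(* The notations of mpoly clash with those of mathcomp-analysis. *)
From mathcomp.multinomials Require Import -(notations) mpoly.

Set Implicit Arguments.
Unset Strict Implicit.
Unset Printing Implicit Defensive.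

Import Order.TTheory GRing.Theory Num.Theory.

Local Open Scope ring_scope.

(* exp(2 pi i / m), written out by Euler's formula. *)
Definition zeta (R : realType) (m : nat) : R[i] :=
  Complex (cos (pi *+ 2 / m%:R)) (sin (pi *+ 2 / m%:R)).

(* The field C(x_1, .., x_n, y_1, .., y_n), where C is R[i]; the first n of the
   n + n variables are the x_i and the last n are the y_i. *)
Definition ratfun (R : realType) (n : nat) : fieldType :=
  {fraction (mpoly (n + n) R[i])}.

Definition ratC (R : realType) (n : nat) (c : R[i]) : ratfun R n :=
  tofrac (mpolyC (n + n) c).

Definition indet_x (R : realType) (n : nat) : 'rV[ratfun R n]_n :=
  \row_i tofrac (mpolyX R[i] (mnm1 (lshift n i))).

Definition indet_y (R : realType) (n : nat) : 'rV[ratfun R n]_n :=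
  \row_i tofrac (mpolyX R[i] (mnm1 (rshift n i))).

Section PartitionFunction.

Variable K : fieldType.

Definition sigma (t : K) : K := t - t^-1.

Definition M_UU (n : nat) (x y : 'rV[K]_n) (a b c : K) : 'M[K]_n :=
  \matrix_(i, j)
    (  sigma (b / y 0 j) * sigma (c * x 0 i) / sigma (a * x 0 i / y 0 j)
     - sigma (b / y 0 j) * sigma (c / x 0 i) / sigma (a / (x 0 i * y 0 j))
     - sigma (b * y 0 j) * sigma (c * x 0 i) / sigma (a * x 0 i * y 0 j)
     + sigma (b * y 0 j) * sigma (c / x 0 i) / sigma (a * y 0 j / x 0 i)).

Definition F_V (n : nat) (x y : 'rV[K]_n) (a : K) : K :=
  (\prod_(i < n) \prod_(j < n)
     (sigma (a * x 0 i / y 0 j) * sigma (a * y 0 j / x 0 i)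
      * sigma (a * x 0 i * y 0 j) * sigma (a / (x 0 i * y 0 j))))
  / ((\prod_(i < n) \prod_(j < n | (i < j)%N)
        (sigma (x 0 j / x 0 i) * sigma (y 0 i / y 0 j)))
     * (\prod_(i < n) \prod_(j < n | (i <= j)%N)
        (sigma (1 / (x 0 i * x 0 j)) * sigma (y 0 i * y 0 j)))).

(* A_VHP^(2) of order 4n+2; the argument is n, not the order. *)
Definition A2_VHP (n : nat) (x y : 'rV[K]_n) (a : K) : K :=
  sigma a ^- (2 * n ^ 2 + n) * F_V x y a
  * ((-1) ^+ n * \det (M_UU x y a a a^-1)).

(* In both characters nth supplies "first N entries, padded with zeros", and
   the column index j is counted from 0, so the mathematical index is j + 1. *)
Definition GLchar (N : nat) (l : seq nat) (z : 'rV[K]_N) : K :=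
  \det (\matrix_(i < N, j < N) z 0 i ^+ (nth 0 l j + (N - j.+1))%N)
  / \det (\matrix_(i < N, j < N) z 0 i ^+ (N - j.+1)).

(* The character of Sp_{2N}: N is the number of variables. *)
Definition Spchar (N : nat) (l : seq nat) (z : 'rV[K]_N) : K :=
  \det (\matrix_(i < N, j < N)
          (z 0 i ^+ (nth 0 l j + (N - j.+1) + 1)%N
           - z 0 i ^- (nth 0 l j + (N - j.+1) + 1)%N))
  / \det (\matrix_(i < N, j < N)
          (z 0 i ^+ (N - j.+1 + 1)%N - z 0 i ^- (N - j.+1 + 1)%N)).

End PartitionFunction.

(* For d > 0, the sequence of all r - d * k >= 0 with k natural, in decreasing
   order; d = 1 and d = 2 give delta(r) and delta^2(r). *)
Definition delta_seq (d : nat) (r : int) : seq nat :=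
  if r is Posz m then [seq (m - d * k)%N | k <- iota 0 (m %/ d).+1] else [::].

(* delta_merge 1 r s and delta_merge 2 r s are delta(r, s) and delta^2(r, s). *)
Definition delta_merge (d : nat) (r s : int) : seq nat :=
  sort geq (delta_seq d r ++ delta_seq d s).

(* Main.v *)
(* Put X = x^2 + x^-2, Y = y^2 + y^-2 and c = a^2 + a^-2, so that c = -2, -1, 0
   at a = zeta_4, zeta_6, zeta_8.  Every entry of M_UU(x, y; a, a, a^-1) equals
   sigma(a) sigma(x^2) sigma(y^2) ((1 + c) X - Y - (2 + c)) / D  with
   D = c^2 - c X Y + X^2 + Y^2 - 4, and the factors D make up the numerator of
   F_V.  For c = -2 this is a Cauchy determinant.  In the other two cases the
   entry has, up to row and column factors, the form (b_j - a_i) / (v_j - u_i);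
   by Lagrange interpolation one half of the 2n x 2n determinant with rows
   (u_i^k, a_i u_i^k), (v_j^k, b_j v_j^k) can be eliminated, which leaves the
   n x n determinant of these entries.
   For c = -1, u = X^3 - 3X = x^6 + x^-6 and a = X, and the large determinant is
   the numerator of the symplectic character up to unitriangular column
   operations.  For c = 0, u = X^2 - 2, v = 2 - Y^2, a = X - 1, b = Y + 1;
   when y = x, combining the two rows attached to x_i with coefficients
   x +- x^3, and x^-1 +- x^-3, turns them into rows of powers of x^8 and x^-8,
   which form the numerator of the GL character. *)

Require Import Defs.
From mathcomp Require Import all_boot all_order all_algebra.
From mathcomp Require Import reals trigo ring zify perm.
From mathcomp.real_closed Require Import complex.
From mathcomp.multinomials Require Import -(notations) mpoly.

Import Order.TTheory GRing.Theory Num.Theory.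
Local Open Scope ring_scope.

Set Implicit Arguments.
Unset Strict Implicit.
Unset Printing Implicit Defensive.

(** * Vandermonde and Cauchy determinants *)

(** The sign (-1)^(n(n-1)/2), kept as a product over pairs so that it merges factorwise with
    Vandermonde products. *)
Definition pairs_sign (R : comPzRingType) n : R :=
  \prod_(i < n) \prod_(j < n | (i < j)%N) (-1).

Lemma rmorph_pairs_sign (R S : comPzRingType) (f : {rmorphism R -> S}) n :
  f (pairs_sign R n) = pairs_sign S n.
Proof.
rewrite rmorph_prod; apply: eq_bigr => i _.
by rewrite rmorph_prod; apply: eq_bigr => j _; rewrite rmorphN1.
Qed.

Section Vandermonde.

Variable K : fieldType.

Definition vdm n (x : 'rV[K]_n) : K :=
  \prod_(i < n) \prod_(j < n | (i < j)%N) (x 0 j - x 0 i).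

Definition powers_mx n (x : 'rV[K]_n) : 'M[K]_n := \matrix_(i, k) x 0 i ^+ k.

Lemma det_powers_mx n (x : 'rV[K]_n) : \det (powers_mx x) = vdm x.
Proof.
rewrite /vdm -(det_Vandermonde x) -det_tr; congr (\det _).
by apply/matrixP => i j; rewrite !mxE.
Qed.

Lemma pairs_sign_sqr n : pairs_sign K n * pairs_sign K n = 1.
Proof.
rewrite -big_split big1 //= => i _; rewrite -big_split big1 //= => j _.
by rewrite mulrNN mulr1.
Qed.

Lemma vdm_opp n (x : 'rV[K]_n) : vdm (- x) = pairs_sign K n * vdm x.
Proof.
rewrite -big_split; apply: eq_bigr => i _; rewrite -big_split /=.
by apply: eq_bigr => j _; rewrite !mxE mulN1r opprB opprK addrC.
Qed.

Lemma vdm_neq0 n (x : 'rV[K]_n) :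
  (forall i j, i != j -> x 0 i != x 0 j) -> vdm x != 0.
Proof.
move=> x_inj; apply/prodf_neq0 => i _; apply/prodf_neq0 => j ij.
by rewrite subr_eq0 x_inj // neq_ltn ij orbT.
Qed.

Lemma prod_pairs n (F : 'I_n -> 'I_n -> K) :
  \prod_(i < n) \prod_(j < n) F i j =
  (\prod_(i < n) F i i) * \prod_(i < n) \prod_(j < n | (i < j)%N) (F i j * F j i).
Proof.
have -> : \prod_(i < n) \prod_(j < n | (i < j)%N) (F i j * F j i) =
  \prod_(i < n) ((\prod_(j < n | (i < j)%N) F i j) * \prod_(j < n | (j < i)%N) F i j).
  rewrite big_split /= [X in _ = _ * X](exchange_big_dep xpredT) //= -big_split /=.
  by apply: eq_bigr => i _; rewrite big_split.
rewrite -big_split /=; apply: eq_bigr => i _; rewrite (bigD1 i) //=; congr (_ * _).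
rewrite (bigID (fun j : 'I_n => (i < j)%N)) /=; congr (_ * _); apply: eq_bigl => j.
  by rewrite neq_ltn; case: ltngtP.
by rewrite neq_ltn; case: ltngtP.
Qed.

Lemma prod_diff_neq n (x : 'rV[K]_n) :
  \prod_(i < n) \prod_(k < n | k != i) (x 0 i - x 0 k) =
  pairs_sign K n * vdm x ^+ 2.
Proof.
transitivity (\prod_(i < n) \prod_(k < n) (if k != i then x 0 i - x 0 k else 1)).
  by apply: eq_bigr => i _; rewrite big_mkcond.
rewrite prod_pairs big1 ?mul1r; last by move=> i _; rewrite eqxx.
rewrite expr2 -!big_split; apply: eq_bigr => i _; rewrite -!big_split.
apply: eq_bigr => j ij.
have /negbTE nij : i != j by rewrite neq_ltn ij.
by rewrite eq_sym nij /=; ring.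
Qed.

Lemma vdm_row_mx m n (x : 'rV[K]_m) (y : 'rV[K]_n) :
  vdm (row_mx x y) =
  vdm x * vdm y * \prod_(j < n) \prod_(i < m) (y 0 j - x 0 i).
Proof.
rewrite /vdm big_split_ord /= exchange_big /= -mulrA.
rewrite [_ * \prod_i _ in RHS]mulrC mulrA -big_split /=.
congr (_ * _); apply: eq_bigr => i _.
  rewrite big_split_ord /=; congr (_ * _).
    by apply: eq_bigr => j _; rewrite !row_mxEl.
  apply: eq_big => [j|j _]; last by rewrite row_mxEl row_mxEr.
  by rewrite (leq_trans (ltn_ord i)) // leq_addr.
rewrite big_split_ord /= big_pred0 ?mul1r.
  by apply: eq_big => [j|j _]; rewrite ?ltn_add2l // !row_mxEr.
by move=> j; apply/negbTE; rewrite -leqNgt (leq_trans (ltnW (ltn_ord j))) ?leq_addr.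
Qed.

(** Entry (j, i) is the i-th Lagrange basis polynomial for the nodes [x], evaluated at y_j. *)
Definition lagrange_mx n (x y : 'rV[K]_n) : 'M[K]_n :=
  \matrix_(j, i) \prod_(k < n | k != i) ((y 0 j - x 0 k) / (x 0 i - x 0 k)).

(** Interpolation at n distinct nodes reproduces every polynomial of degree below n, in particular
    the monomials. *)
Lemma lagrange_mxP n (x y : 'rV[K]_n) :
  (forall i j, i != j -> x 0 i != x 0 j) ->
  lagrange_mx x y *m powers_mx x = powers_mx y.
Proof.
move=> x_inj.
pose l i : {poly K} := \prod_(k < n | k != i) ((x 0 i - x 0 k)^-1 *: ('X - (x 0 k)%:P)).
have lE i t : (l i).[t] = \prod_(k < n | k != i) ((t - x 0 k) / (x 0 i - x 0 k)).
  rewrite horner_prod; apply: eq_bigr => k _.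
  by rewrite hornerZ hornerXsubC mulrC.
have size_l i : (size (l i) <= n)%N.
  apply: leq_trans (size_prod_leq _ _) _.
  have: (\sum_(k < n | k != i) size ((x 0 i - x 0 k)^-1 *: ('X - (x 0 k)%:P))%R <=
         \sum_(k < n | k != i) 2)%N.
    by apply: leq_sum => k _; rewrite (leq_trans (size_scale_leq _ _)) ?size_XsubC.
  rewrite sum_nat_const (eq_card (B := predC1 i)) // cardC1 card_ord => le_s.
  by rewrite leq_subLR addnC (leq_trans (_ : _ <= (n.-1 * 2).+1)%N) //; have := ltn_ord i; lia.
apply/matrixP => j k; rewrite !mxE.
(* The interpolation error has degree below n and vanishes at all n nodes, hence is zero. *)
pose p : {poly K} := 'X^k - \sum_i x 0 i ^+ k *: l i.
suff /(congr1 (horner^~ (y 0 j))): p = 0.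
  rewrite horner0 hornerD hornerN hornerXn horner_sum => /eqP.
  rewrite subr_eq0 => /eqP ->; apply: eq_bigr => i _.
  by rewrite !mxE hornerZ lE mulrC.
apply: (@roots_geq_poly_eq0 _ _ [seq x 0 i | i <- enum 'I_n]).
- apply/allP => _ /mapP[i _ ->]; rewrite /root hornerD hornerN hornerXn horner_sum.
  rewrite (bigD1 i) //= big1 => [|m mi]; rewrite hornerZ lE.
    rewrite big1 ?mulr1 ?addr0 ?subrr // => m mi.
    by rewrite divff // subr_eq0 x_inj // eq_sym.
  by rewrite (bigD1 i) 1?eq_sym //= subrr !mul0r mulr0.
- rewrite map_inj_uniq ?enum_uniq // => i m /eqP.
  by apply: contraTeq => /x_inj.
rewrite size_map size_enum_ord (leq_trans (size_polyD _ _)) // geq_max size_polyXn.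
rewrite ltn_ord size_polyN (leq_trans (size_sum _ _ _)) //.
by apply/bigmax_leqP => i _; rewrite (leq_trans (size_scale_leq _ _)).
Qed.

Definition twisted_powers_mx n (u v a b : 'rV[K]_n) : 'M[K]_(n + n) :=
  block_mx (powers_mx u) (diag_mx a *m powers_mx u)
           (powers_mx v) (diag_mx b *m powers_mx v).

(** Block elimination with the interpolation matrix [Q] clears the lower left block. What remains
    below is B Q - Q A times the Vandermonde matrix of [u], where A and B are the diagonal matrices
    of [a] and [b]. *)
Lemma det_twisted_powers n (u v a b : 'rV[K]_n) :
  (forall i j, i != j -> u 0 i != u 0 j) ->
  (forall i j, v 0 j != u 0 i) ->
  \det (twisted_powers_mx u v a b) =
  pairs_sign K n * (\prod_(j < n) \prod_(i < n) (v 0 j - u 0 i)) *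
  \det (\matrix_(j < n, i < n) ((b 0 j - a 0 i) / (v 0 j - u 0 i))).
Proof.
move=> u_inj uv.
pose Q := lagrange_mx u v.
have QE : Q *m powers_mx u = powers_mx v := lagrange_mxP _ u_inj.
pose C : 'M[K]_n := \matrix_(j, i) ((b 0 j - a 0 i) / (v 0 j - u 0 i)).
pose r := \row_j \prod_(k < n) (v 0 j - u 0 k).
pose s := \row_i (\prod_(k < n | k != i) (u 0 i - u 0 k))^-1.
(* [Q] has the entries r_j s_i / (v_j - u_i), so the difference is [C] with scaled rows and
   columns. *)
have factorC : diag_mx b *m Q - Q *m diag_mx a = diag_mx r *m C *m diag_mx s.
  apply/matrixP => j i; rewrite !mul_mx_diag !mul_diag_mx !mxE.
  rewrite prodf_div [in RHS](bigD1 i) //=.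
  have vu0 : v 0 j - u 0 i != 0 by rewrite subr_eq0 uv.
  have d0 : \prod_(k < n | k != i) (u 0 i - u 0 k) != 0.
    by apply/prodf_neq0 => k ki; rewrite subr_eq0 u_inj // eq_sym.
  by field; rewrite d0 vu0.
have elim_v : block_mx 1%:M 0 (- Q) 1%:M *m twisted_powers_mx u v a b =
    block_mx (powers_mx u) (diag_mx a *m powers_mx u)
             0 ((diag_mx b *m Q - Q *m diag_mx a) *m powers_mx u).
  rewrite mulmx_block !mul1mx !mul0mx !addr0 !mulNmx QE addNr mulmxBl -!mulmxA QE.
  by rewrite [- _ + _]addrC.
have := congr1 (fun M => \det M) elim_v.
rewrite det_mulmx det_lblock !det1 !mul1r det_ublock factorC !det_mulmx !det_diag => ->.
rewrite det_powers_mx.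
have -> : \prod_i r 0 i = \prod_(j < n) \prod_(i < n) (v 0 j - u 0 i).
  by apply: eq_bigr => j _; rewrite mxE.
have -> : \prod_i s 0 i = \prod_(i < n) (\prod_(k < n | k != i) (u 0 i - u 0 k))^-1.
  by apply: eq_bigr => j _; rewrite mxE.
(* The product of the s_i is, up to sign, the inverse square of [vdm u]; it cancels the Vandermonde
   factors of both diagonal blocks. *)
rewrite prodfV prod_diff_neq.
have vu0 := vdm_neq0 u_inj.
have := pairs_sign_sqr n; set e := pairs_sign K n => ee.
have e0 : e != 0 by apply/eqP => e0; move/eqP: ee; rewrite e0 mul0r eq_sym oner_eq0.
by field : ee; rewrite vu0 e0.
Qed.

(** With a = 0 and b = 1 the large matrix is block lower triangular, its diagonal blocks being the
    Vandermonde matrices of [u] and [v]. *)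
Lemma det_cauchy n (u v : 'rV[K]_n) :
  (forall i j, i != j -> u 0 i != u 0 j) ->
  (forall i j, v 0 j != u 0 i) ->
  (\prod_(j < n) \prod_(i < n) (v 0 j - u 0 i)) *
  \det (\matrix_(j < n, i < n) (v 0 j - u 0 i)^-1) =
  pairs_sign K n * vdm u * vdm v.
Proof.
move=> u_inj uv.
have := det_twisted_powers 0 (const_mx 1) u_inj uv.
rewrite /twisted_powers_mx linear0 mul0mx diag_const_mx mul1mx.
rewrite det_lblock !det_powers_mx => /(congr1 ( *%R (pairs_sign K n))).
rewrite !mulrA pairs_sign_sqr mul1r => ->; congr (_ * \det _).
by apply/matrixP => i j; rewrite !mxE subr0 mul1r.
Qed.

End Vandermonde.

(** * Alternating the columns of the two blocks *)

(** The column order 1, a, u, a u, u^2, a u^2, ... is the one in which the character numerators are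
    reached by unitriangular operations. *)
Definition interleaved_mx (R : pzRingType) n (u a : 'rV[R]_n) : 'M[R]_n :=
  \matrix_(r, k) (u 0 r ^+ k./2 * a 0 r ^+ odd k).

Definition interleave (R : pzRingType) n : 'M[R]_(n + n) :=
  row_mx (\matrix_(k < n + n, i < n) (k == i.*2 :> nat)%:R)
         (\matrix_(k < n + n, i < n) (k == i.*2.+1 :> nat)%:R).

Lemma sum_delta (R : pzRingType) n (F : 'I_n -> R) m (lt_mn : (m < n)%N) :
  \sum_(k < n) F k * (k == m :> nat)%:R = F (Ordinal lt_mn).
Proof.
rewrite (bigD1 (Ordinal lt_mn)) //= eqxx mulr1 big1 ?addr0 // => k.
by rewrite -val_eqE => /negbTE /= ->; rewrite mulr0.
Qed.

Lemma interleaved_mxE (K : fieldType) n (u v a b : 'rV[K]_n) :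
  interleaved_mx (row_mx u v) (row_mx a b) *m interleave K n =
  twisted_powers_mx u v a b.
Proof.
have lt0 (i : 'I_n) : (i.*2 < n + n)%N by have := ltn_ord i; lia.
have lt1 (i : 'I_n) : (i.*2.+1 < n + n)%N by have := ltn_ord i; lia.
apply/matrixP => r k; rewrite !mxE.
under eq_bigr => i _ do rewrite !mxE.
case: (splitP r) => r' _; rewrite !mxE.
- case: (splitP k) => k' _.
    under eq_bigr => i _ do rewrite mxE.
    by rewrite (sum_delta _ (lt0 k')) /= odd_double doubleK mulr1 mxE.
  under eq_bigr => i _ do rewrite mxE.
  by rewrite (sum_delta _ (lt1 k')) /= odd_double uphalf_double mul_diag_mx !mxE expr1 mulrC.
- case: (splitP k) => k' _.
    under eq_bigr => i _ do rewrite mxE.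
    by rewrite (sum_delta _ (lt0 k')) /= odd_double doubleK mulr1 mxE.
under eq_bigr => i _ do rewrite mxE.
by rewrite (sum_delta _ (lt1 k')) /= odd_double uphalf_double mul_diag_mx !mxE expr1 mulrC.
Qed.

(* For u = t^2 and a = t the interleaved matrix is the Vandermonde matrix of t,
   so one rational specialization fixes the sign of the permutation. *)
Lemma det_interleave_rat n : \det (interleave rat n) = pairs_sign rat n.
Proof.
(* These nodes are positive and all distinct, so their squares stay distinct and no sum x_i + y_j
   vanishes. *)
pose x : 'rV[rat]_n := \row_i i.+1%:R.
pose y : 'rV[rat]_n := \row_i (n + i).+1%:R.
pose sq (z : 'rV[rat]_n) : 'rV[rat]_n := \row_i z 0 i ^+ 2.
have sqE z i : sq z 0 i = z 0 i ^+ 2 by rewrite mxE.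
have oppE (z : 'rV[rat]_n) i : (- z) 0 i = - z 0 i by rewrite mxE.
have x_gt0 i : 0 < x 0 i by rewrite mxE ltr0n.
have y_gt0 i : 0 < y 0 i by rewrite mxE ltr0n.
have x_inj i j : i != j -> x 0 i != x 0 j.
  by rewrite !mxE eqr_nat eqSS.
have y_inj i j : i != j -> y 0 i != y 0 j.
  by rewrite !mxE eqr_nat eqSS eqn_add2l.
have xy i j : y 0 j != x 0 i.
  by rewrite !mxE eqr_nat eqSS; have := ltn_ord i; lia.
have sqx_inj i j : i != j -> sq x 0 i != sq x 0 j.
  by move=> ij; rewrite !sqE eqrXn2 ?ltW // x_inj.
have sqxy i j : sq y 0 j != sq x 0 i.
  by rewrite !sqE eqrXn2 ?ltW // xy.
have /(congr1 (fun M => \det M)) := interleaved_mxE (sq x) (sq y) x y.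
have -> : interleaved_mx (row_mx (sq x) (sq y)) (row_mx x y) = powers_mx (row_mx x y).
  apply/matrixP => r k; rewrite !mxE.
  case: (splitP r) => r' _; rewrite !mxE -exprM -exprD; congr (_ ^+ _); lia.
rewrite det_mulmx det_powers_mx vdm_row_mx det_twisted_powers //.
have nx_inj i j : i != j -> (- x) 0 i != (- x) 0 j.
  by move=> ij; rewrite !oppE eqr_opp x_inj.
have nxy i j : y 0 j != (- x) 0 i.
  rewrite oppE gt_eqF //; apply: lt_trans (y_gt0 j).
  by rewrite oppr_lt0.
(* Since (y - x) / (y^2 - x^2) = 1 / (y + x), the small determinant is a Cauchy determinant with
   nodes -x and y. *)
have := det_cauchy nx_inj nxy; rewrite vdm_opp mulrA pairs_sign_sqr mul1r.
have -> : \matrix_(j < n, i < n) ((y 0 j - x 0 i) / (sq y 0 j - sq x 0 i)) =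
   \matrix_(j < n, i < n) (y 0 j - (- x) 0 i)^-1.
  apply/matrixP => j i; rewrite mxE [in RHS]mxE oppE !sqE.
  have yx0 : y 0 j - x 0 i != 0 by rewrite subr_eq0.
  by rewrite opprK subr_sqr invfM mulrA divff ?mul1r.
set D := \det _ => cauchy.
have -> : \prod_(j < n) \prod_(i < n) (sq y 0 j - sq x 0 i) =
  (\prod_(j < n) \prod_(i < n) (y 0 j - x 0 i)) *
  \prod_(j < n) \prod_(i < n) (y 0 j - (- x) 0 i).
  rewrite -big_split; apply: eq_bigr => j _; rewrite -big_split.
  by apply: eq_bigr => i _; rewrite oppE !sqE opprK subr_sqr.
set PA := \prod_(j < n) \prod_(i < n) (y 0 j - x 0 i) => interleaveE.
have nz : vdm x * vdm y * PA != 0.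
  rewrite !mulf_neq0 ?vdm_neq0 //.
  by apply/prodf_neq0 => j _; apply/prodf_neq0 => i _; rewrite subr_eq0.
by apply: (mulfI nz); rewrite interleaveE -cauchy; ring.
Qed.

(** The entries are 0 and 1, so the determinant is the image of an integer, and the rational case
    determines that integer. *)
Lemma det_interleave (R : comNzRingType) n :
  \det (interleave R n) = pairs_sign R n.
Proof.
have mapE (S : comNzRingType) : interleave S n = map_mx intr (interleave int n).
  rewrite map_row_mx; congr row_mx; apply/matrixP => i j;
  by rewrite !mxE; case: eqP.
rewrite mapE det_map_mx -(rmorph_pairs_sign intr n); congr (_%:~R).
apply/eqP; rewrite -(eqr_int rat) (rmorph_pairs_sign intr n).
by rewrite -det_map_mx -mapE det_interleave_rat.
Qed.

Lemma det_interleaved (K : fieldType) n (u v a b : 'rV[K]_n) :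
  \det (twisted_powers_mx u v a b) =
  pairs_sign K n * \det (interleaved_mx (row_mx u v) (row_mx a b)).
Proof. by rewrite -interleaved_mxE det_mulmx det_interleave mulrC. Qed.

(** The sign of the column permutation cancels the sign in [det_twisted_powers]. *)
Lemma det_interleaved_cauchy (K : fieldType) n (u v a b : 'rV[K]_n) :
  (forall i j, i != j -> u 0 i != u 0 j) ->
  (forall i j, v 0 j != u 0 i) ->
  \det (interleaved_mx (row_mx u v) (row_mx a b)) =
  (\prod_(j < n) \prod_(i < n) (v 0 j - u 0 i)) *
  \det (\matrix_(j < n, i < n) ((b 0 j - a 0 i) / (v 0 j - u 0 i))).
Proof.
move=> u_inj uv; have := det_twisted_powers a b u_inj uv.
rewrite det_interleaved -mulrA => /(congr1 ( *%R (pairs_sign K n))).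
by rewrite !(mulrA (pairs_sign K n)) pairs_sign_sqr !mul1r.
Qed.

(** * The partition function *)

Section PartitionFunction.

Variable K : fieldType.

(** Its values at x_i, y_j and a are the X, Y and c of the overview; [UU_den] is the D there. *)
Definition sqsum (t : K) : K := t ^+ 2 + t ^- 2.

Definition sqsum_row n (x : 'rV[K]_n) : 'rV[K]_n := \row_i sqsum (x 0 i).

Definition UU_num (c s t : K) : K := (1 + c) * s - t - (2 + c).

Definition UU_den (c s t : K) : K := c ^+ 2 - c * s * t + s ^+ 2 + t ^+ 2 - 4.

(** The first two factors give c - (x^2/y^2 + y^2/x^2), the last two c - (x^2 y^2 + x^-2 y^-2). The
    two subtracted sums add up to X Y and multiply to X^2 + Y^2 - 4. *)
Lemma sigma_prod (a x y : K) : a != 0 -> x != 0 -> y != 0 ->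
  sigma (a * x / y) * sigma (a * y / x) * sigma (a * x * y) * sigma (a / (x * y)) =
  UU_den (sqsum a) (sqsum x) (sqsum y).
Proof.
by move=> a0 x0 y0; rewrite /UU_den /sqsum /sigma; field; rewrite a0 x0 y0.
Qed.

Lemma M_UU_entry (a x y : K) : a != 0 -> x != 0 -> y != 0 ->
  UU_den (sqsum a) (sqsum x) (sqsum y) != 0 ->
  sigma (a / y) * sigma (a^-1 * x) / sigma (a * x / y)
  - sigma (a / y) * sigma (a^-1 / x) / sigma (a / (x * y))
  - sigma (a * y) * sigma (a^-1 * x) / sigma (a * x * y)
  + sigma (a * y) * sigma (a^-1 / x) / sigma (a * y / x) =
  sigma a * sigma (x ^+ 2) * sigma (y ^+ 2) *
  (UU_num (sqsum a) (sqsum x) (sqsum y) / UU_den (sqsum a) (sqsum x) (sqsum y)).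
Proof.
move=> a0 x0 y0; rewrite -sigma_prod // !mulf_eq0 !negb_or => /andP[/andP[/andP[]]].
(* Clearing the four denominators first leaves an identity of Laurent polynomials. *)
have : sigma (a / y) * sigma (a^-1 * x)
         * (sigma (a * y / x) * sigma (a * x * y) * sigma (a / (x * y)))
       - sigma (a / y) * sigma (a^-1 / x)
         * (sigma (a * x / y) * sigma (a * y / x) * sigma (a * x * y))
       - sigma (a * y) * sigma (a^-1 * x)
         * (sigma (a * x / y) * sigma (a * y / x) * sigma (a / (x * y)))
       + sigma (a * y) * sigma (a^-1 / x)
         * (sigma (a * x / y) * sigma (a * x * y) * sigma (a / (x * y))) =
       sigma a * sigma (x ^+ 2) * sigma (y ^+ 2) *
       UU_num (sqsum a) (sqsum x) (sqsum y).
  by rewrite /UU_num /sqsum /sigma; field; rewrite a0 x0 y0 oner_neq0.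
move: (sigma (a / y)) (sigma (a^-1 * x)) (sigma (a^-1 / x)) (sigma (a * y)) => p q r s.
move: (sigma (a * x / y)) (sigma (a * y / x)) (sigma (a * x * y)) (sigma (a / (x * y))).
move=> s1 s2 s3 s4 E s10 s20 s30 s40; rewrite mulrA -E.
by field; rewrite s10 s20 s30 s40.
Qed.

(** For i < j the x-factors multiply to X_i - X_j and the y-factors to Y_i - Y_j; each diagonal term
    is -sigma(x_i^2) sigma(y_i^2). *)
Lemma F_V_den n (x y : 'rV[K]_n) :
  (forall i, x 0 i != 0) -> (forall i, y 0 i != 0) ->
  (\prod_(i < n) \prod_(j < n | (i < j)%N)
     (sigma (x 0 j / x 0 i) * sigma (y 0 i / y 0 j)))
  * (\prod_(i < n) \prod_(j < n | (i <= j)%N)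
     (sigma (1 / (x 0 i * x 0 j)) * sigma (y 0 i * y 0 j))) =
  (-1) ^+ n * (\prod_(i < n) sigma (x 0 i ^+ 2)) * (\prod_(i < n) sigma (y 0 i ^+ 2))
  * (vdm (sqsum_row x) * vdm (sqsum_row y)).
Proof.
move=> x0 y0; rewrite -[X in (-1) ^+ X](card_ord n) -prodr_const -!big_split /=.
apply: eq_bigr => i _; rewrite [X in _ * X = _](bigD1 i) //= mulrCA; congr (_ * _).
  by rewrite /sigma; field; rewrite !x0 !y0 ?oner_neq0.
rewrite [X in _ * X](eq_bigl (fun j : 'I_n => (i < j)%N)) => [|j]; last first.
  by rewrite ltn_neqAle eq_sym andbC.
rewrite -!big_split; apply: eq_bigr => j _; rewrite !mxE /sigma /sqsum /=.
by field; rewrite !x0 !y0 ?oner_neq0.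
Qed.

Lemma sqr_sigma (a : K) : a != 0 -> sigma a ^+ 2 = sqsum a - 2.
Proof. by move=> a0; rewrite /sigma /sqsum; field. Qed.

(** The row and column factors of [M_UU] cancel the diagonal part of [F_V_den], the two signs (-1)^n
    cancel, and the powers of sigma(a) combine to sigma(a)^(-2n^2) = (c - 2)^(-n^2). *)
Lemma A2_VHP_det n (x y : 'rV[K]_n) (a : K) :
  a != 0 -> sigma a != 0 ->
  (forall i, x 0 i != 0) -> (forall i, y 0 i != 0) ->
  (forall i, sigma (x 0 i ^+ 2) != 0) -> (forall i, sigma (y 0 i ^+ 2) != 0) ->
  (forall i j, UU_den (sqsum a) (sqsum (x 0 i)) (sqsum (y 0 j)) != 0) ->
  A2_VHP x y a =
  (sqsum a - 2) ^- (n ^ 2)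
  * (\prod_(i < n) \prod_(j < n) UU_den (sqsum a) (sqsum (x 0 i)) (sqsum (y 0 j)))
  * \det (\matrix_(i < n, j < n) (UU_num (sqsum a) (sqsum (x 0 i)) (sqsum (y 0 j))
                          / UU_den (sqsum a) (sqsum (x 0 i)) (sqsum (y 0 j))))
  / (vdm (sqsum_row x) * vdm (sqsum_row y)).
Proof.
move=> a0 sa0 x0 y0 sx0 sy0 den0; rewrite /A2_VHP /F_V F_V_den //.
under eq_bigr => i _ do under eq_bigr => j _ do rewrite sigma_prod //.
set P := \prod_(i < n) \prod_(j < n) _; set C := \matrix_(i, j) (_ / _).
have -> : M_UU x y a a a^-1 =
    diag_mx (\row_i (sigma a * sigma (x 0 i ^+ 2))) *m C
    *m diag_mx (\row_j sigma (y 0 j ^+ 2)).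
  apply/matrixP => i j; rewrite mul_mx_diag mul_diag_mx !mxE.
  by rewrite M_UU_entry //; ring.
rewrite !det_mulmx !det_diag.
under eq_bigr => i _ do rewrite mxE.
under [X in _ * (_ * (_ * _ * X))]eq_bigr => i _ do rewrite mxE.
rewrite big_split /= prodr_const card_ord.
have : \prod_(i < n) sigma (x 0 i ^+ 2) != 0 by apply/prodf_neq0 => i _.
have : \prod_(i < n) sigma (y 0 i ^+ 2) != 0 by apply/prodf_neq0 => i _.
move: (\prod_(i < n) _) (\prod_(i < n) _) => sy sx sy0' sx0'.
rewrite -sqr_sigma // -exprM exprD; move: (vdm _ * vdm _) => W; rewrite [(_ * W)^-1]invfM.
move: W^-1 => V.
have sgn0 : (-1) ^+ n != 0 :> K by rewrite signr_eq0.
have san0 : sigma a ^+ n != 0 by rewrite expf_neq0.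
have san1 : sigma a ^+ (2 * n ^ 2) != 0 by rewrite expf_neq0.
by field; rewrite sy0' sx0' sgn0 san0 san1 ?oner_neq0.
Qed.

End PartitionFunction.

Lemma sign_sqr (R : pzRingType) n : (-1) ^+ (n ^ 2) = (-1) ^+ n :> R.
Proof. by rewrite -signr_odd oddX signr_odd. Qed.

(** * The fourth root of unity *)

Section Order4.

Variables (K : fieldType) (n : nat) (x y : 'rV[K]_n) (a : K).
Hypotheses (a0 : a != 0) (sqa : sqsum a = - 2) (K2 : 2 != 0 :> K).
Hypotheses (x0 : forall i, x 0 i != 0) (y0 : forall i, y 0 i != 0).
Hypotheses (sx0 : forall i, sigma (x 0 i ^+ 2) != 0)
           (sy0 : forall i, sigma (y 0 i ^+ 2) != 0).
Hypotheses (x_inj : forall i j, i != j -> sqsum (x 0 i) != sqsum (x 0 j))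
           (y_inj : forall i j, i != j -> sqsum (y 0 i) != sqsum (y 0 j))
           (xy0 : forall i j, sqsum (x 0 i) + sqsum (y 0 j) != 0).

(** For c = -2 the numerator is -(X + Y) and D = (X + Y)^2, so the entries are -1/(X + Y). *)
Lemma A2_VHP_order4 :
  A2_VHP x y a =
    2 ^- (2 * n ^ 2)
    * (\prod_(i < n) (x 0 i ^- (2 * n) * y 0 i ^- (2 * n)))
    * (\prod_(i < n) \prod_(j < n)
         ((x 0 i ^+ 2 + y 0 j ^+ 2) * (1 + x 0 i ^+ 2 * y 0 j ^+ 2))).
Proof.
have sqa4 : sqsum a - 2 = -1 * 2 ^+ 2 by rewrite sqa; ring.
have sa0 : sigma a != 0.
  by rewrite -sqrf_eq0 sqr_sigma // sqa4 mulN1r oppr_eq0 expf_neq0.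
have denE i j : UU_den (sqsum a) (sqsum (x 0 i)) (sqsum (y 0 j)) =
    (sqsum (x 0 i) + sqsum (y 0 j)) ^+ 2.
  by rewrite sqa /UU_den; ring.
have den0 i j : UU_den (sqsum a) (sqsum (x 0 i)) (sqsum (y 0 j)) != 0.
  by rewrite denE expf_neq0.
rewrite A2_VHP_det //; set C := \matrix_(i, j) _.
pose u := - sqsum_row x; pose v := sqsum_row y.
have CE : C = -1 *: (\matrix_(j < n, i < n) (v 0 j - u 0 i)^-1)^T.
  apply/matrixP => i j; rewrite !mxE denE /UU_num sqa opprK.
  rewrite (_ : _ - _ - _ = - (sqsum (x 0 i) + sqsum (y 0 j))); last by ring.
  rewrite [sqsum (y 0 j) + _]addrC; move: (xy0 i j); move: (_ + _) => s s0.
  by field; rewrite s0.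
have u_inj i j : i != j -> u 0 i != u 0 j.
  by rewrite !mxE eqr_opp; apply: x_inj.
have uv i j : v 0 j != u 0 i.
  by rewrite !mxE -addr_eq0 addrC xy0.
have := det_cauchy u_inj uv; rewrite vdm_opp mulrA pairs_sign_sqr mul1r.
rewrite CE detZ det_tr; set D := \det _.
have -> : \prod_(j < n) \prod_(i < n) (v 0 j - u 0 i) =
  \prod_(i < n) \prod_(j < n) (sqsum (x 0 i) + sqsum (y 0 j)).
  rewrite exchange_big; apply: eq_bigr => i _; apply: eq_bigr => j _.
  by rewrite !mxE opprK addrC.
set P := \prod_(i < n) _ => cauchy.
(* X + Y = (x^2 + y^2)(1 + x^2 y^2) / (x^2 y^2). *)
have -> : \prod_(i < n) \prod_(j < n)
      ((x 0 i ^+ 2 + y 0 j ^+ 2) * (1 + x 0 i ^+ 2 * y 0 j ^+ 2)) =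
    \prod_(i < n) \prod_(j < n) (x 0 i ^+ 2 * y 0 j ^+ 2) *
    P.
  rewrite -big_split; apply: eq_bigr => i _; rewrite -big_split.
  by apply: eq_bigr => j _; rewrite /sqsum /=; field; rewrite x0 y0 ?oner_neq0.
under eq_bigr => i _ do under eq_bigr => j _ do rewrite denE.
have -> : \prod_(i < n) \prod_(j < n) (x 0 i ^+ 2 * y 0 j ^+ 2) =
   (\prod_(i < n) (x 0 i ^- (2 * n) * y 0 i ^- (2 * n)))^-1.
  under eq_bigr => i _ do rewrite big_split /= prodr_const card_ord -exprM.
  rewrite big_split /= prodr_const card_ord -prodrXl -prodfV -big_split /=.
  by apply: eq_bigr => i _; rewrite invfM !invrK -exprM.
under eq_bigr => i _ do rewrite prodrXl.
set Q := \prod_(i < n) (_ * _).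
have Q0 : Q != 0.
  by apply/prodf_neq0 => i _; rewrite mulf_neq0 // invr_neq0 // expf_neq0.
have V0 : vdm (sqsum_row x) * vdm (sqsum_row y) != 0.
  by rewrite mulf_neq0 // vdm_neq0 // => i j ij; rewrite !mxE ?x_inj ?y_inj.
(* The Vandermonde denominator equals [P * D], so one of the two factors [P] survives. Here c - 2 =
   -4 supplies the power of 2 and a sign that cancels the one from [C]. *)
rewrite prodrXl -/P -cauchy sqa4 exprMn sign_sqr -exprM.
move: V0; rewrite -cauchy mulf_eq0 negb_or => /andP[P0 D0].
have sgn0 : (-1) ^+ n != 0 :> K by rewrite signr_eq0.
have pow0 : 2 ^+ (2 * n ^ 2) != 0 :> K by rewrite expf_neq0.
by field; rewrite sgn0 P0 D0 Q0 pow0.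
Qed.

End Order4.

(** * Numerators and denominators of the characters *)

Section Span.

Variables (K : fieldType) (n : nat).
Implicit Types (b f : nat -> 'cV[K]_n).

(** The coefficients are scalars shared by all rows, so membership describes a column operation with
    the columns before k. *)
Definition in_span b k (v : 'cV[K]_n) :=
  exists c : nat -> K, v = \sum_(j < k) c j *: b j.

Lemma in_span0 b k : in_span b k 0.
Proof. by exists (fun=> 0); rewrite big1 // => j _; rewrite scale0r. Qed.

Lemma in_spanD b k v w : in_span b k v -> in_span b k w -> in_span b k (v + w).
Proof.
move=> [c ->] [d ->]; exists (fun j => c j + d j).
by rewrite -big_split; apply: eq_bigr => j _; rewrite scalerDl.
Qed.

Lemma in_spanZ b k a v : in_span b k v -> in_span b k (a *: v).
Proof.
move=> [c ->]; exists (fun j => a * c j).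
by rewrite scaler_sumr; apply: eq_bigr => j _; rewrite scalerA.
Qed.

Lemma in_span_sum b k m (F : 'I_m -> 'cV[K]_n) :
  (forall i, in_span b k (F i)) -> in_span b k (\sum_i F i).
Proof.
move=> spanF; elim/big_ind: _ => [|v w|//]; first exact: in_span0.
exact: in_spanD.
Qed.

Lemma in_span_mem b k j : (j < k)%N -> in_span b k (b j).
Proof.
move=> lt_jk; exists (fun i => (i == j)%:R).
rewrite (bigD1 (Ordinal lt_jk)) //= eqxx scale1r big1 ?addr0 // => i.
by rewrite -val_eqE => /negbTE /= ->; rewrite scale0r.
Qed.

Lemma in_span_leq b k l v : (k <= l)%N -> in_span b k v -> in_span b l v.
Proof.
move=> le_kl [c ->]; apply: in_span_sum => j; apply/in_spanZ/in_span_mem.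
exact: leq_trans le_kl.
Qed.

(** The two matrices differ by an upper unitriangular right factor, which collects the
    coefficients. *)
Lemma det_unitriangular b f :
  (forall k, (k < n)%N -> in_span b k (f k - b k)) ->
  \det (\matrix_(i, k < n) f k i 0) = \det (\matrix_(i, k < n) b k i 0).
Proof.
move=> fb; have {fb} fb (k : 'I_n) := fb k (ltn_ord k).
have [C fE] := fin_all_exists fb.
pose T : 'M[K]_n := \matrix_(j, k) (if (j < k)%N then C k j else (j == k)%:R).
have -> : \matrix_(i, k < n) f k i 0 = (\matrix_(i, k < n) b k i 0) *m T.
  apply/matrixP => i k; rewrite !mxE -[f k](subrK (b k)) fE mxE summxE.
  rewrite [RHS](bigID (fun j : 'I_n => (j < k)%N)) /=; congr (_ + _).
    rewrite (big_ord_widen _ (fun j => (C k j *: b j) i 0) (ltnW (ltn_ord k))).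
    by apply: eq_bigr => j jk; rewrite !mxE jk mulrC.
  rewrite (bigD1 k) ?ltnn //= !mxE ltnn eqxx mulr1 big1 ?addr0 // => j.
  by case/andP=> /negbTE jk /negbTE kj; rewrite !mxE jk kj mulr0.
suff detT : \det T = 1 by rewrite det_mulmx detT mulr1.
rewrite -det_tr det_trig; first by rewrite big1 // => i _; rewrite !mxE ltnn eqxx.
apply/is_trig_mxP => i j ij; rewrite !mxE.
have nji : (j < i)%N = false by apply/negbTE; rewrite -leqNgt ltnW.
by rewrite nji; case: eqP => // ji; rewrite ji ltnn in ij.
Qed.

(** Write f_k - b_k as (f_k - D f_(k-s)) + D (f_(k-s) - b_(k-s)). By induction the first part lies
    in the span of earlier b_j; in the second, [D] shifts each b_j to b_(j+s). *)
Lemma in_span_recurrence (D : 'M[K]_n) b f s :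
  (0 < s)%N ->
  (forall k, b (k + s)%N = D *m b k) ->
  (forall k, (k < s)%N -> f k = b k) ->
  (forall k, in_span f (k + s) (f (k + s)%N - D *m f k)) ->
  forall k, in_span b k (f k - b k).
Proof.
move=> s_gt0 bS f_init fS; elim/ltn_ind => k IHk.
have [lt_ks|le_sk] := ltnP k s.
  by rewrite f_init // subrr; exact: in_span0.
rewrite -(subnK le_sk); set m := (k - s)%N.
rewrite bS -(subrK (D *m f m) (f (m + s)%N)) -addrA -mulmxBr; apply: in_spanD.
  have [c ->] := fS m; apply: in_span_sum => j; apply: in_spanZ.
  have jk : (j < k)%N by rewrite -(subnK le_sk).
  rewrite -(subrK (b j) (f j)); apply: in_spanD; last exact: in_span_mem.
  by apply: in_span_leq (IHk _ jk); rewrite ltnW.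
have mk : (m < k)%N by rewrite /m; lia.
have [c ->] := IHk _ mk; rewrite mulmx_sumr; apply: in_span_sum => j.
by rewrite -scalemxAr -bS; apply/in_spanZ/in_span_mem; rewrite ltn_add2r.
Qed.

End Span.

(** * Symplectic determinants and column reversal *)

Section Characters.

Variable K : fieldType.

Definition zdiff (z : K) e : K := z ^+ e - z ^- e.

(** z^(k+1) - z^-(k+1) is sigma(z) times a monic polynomial of degree k in z + 1/z, a rescaled
    Chebyshev polynomial of the second kind. *)
Lemma det_Sp_den n (z : 'rV[K]_n) :
  (forall i, z 0 i != 0) ->
  \det (\matrix_(i, k < n) zdiff (z 0 i) k.+1) =
  (\prod_(i < n) sigma (z 0 i)) * vdm (\row_i (z 0 i + (z 0 i)^-1)).
Proof.
move=> z0; set Z := \row_i (_ + _).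
pose f k : 'cV[K]_n := \col_i zdiff (z 0 i) k.+1.
pose b k : 'cV[K]_n := \col_i (sigma (z 0 i) * Z 0 i ^+ k).
transitivity (\det (\matrix_(i, k < n) f k i 0)).
  by congr (\det _); apply/matrixP => i k; rewrite !mxE.
rewrite (@det_unitriangular _ _ b) => [|k _]; last first.
  apply: (@in_span_recurrence _ _ (diag_mx Z) b f 1) => // [m|[] // _|m].
  - by apply/colP => i; rewrite mul_diag_mx !mxE addn1 exprS mulrCA.
  - by apply/colP => i; rewrite !mxE /zdiff /sigma mulr1 !expr1.
  rewrite addn1; case: m => [|m].
    rewrite (_ : _ - _ = 0); first exact: in_span0.
    by apply/colP => i; rewrite mul_diag_mx !mxE /zdiff; field; rewrite z0.
  rewrite (_ : _ - _ = -1 *: f m); first exact/in_spanZ/in_span_mem.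
  apply/colP => i; rewrite mul_diag_mx !mxE /zdiff !exprS.
  by field; rewrite z0 expf_neq0.
rewrite -det_powers_mx.
have -> : \prod_(i < n) sigma (z 0 i) = \det (diag_mx (\row_i sigma (z 0 i))).
  by rewrite det_diag; apply: eq_bigr => i _; rewrite mxE.
rewrite -det_mulmx; congr (\det _).
by apply/matrixP => i k; rewrite mul_diag_mx !mxE.
Qed.

(** The exponents 1, 2, 4, 5, 7, 8, ... skip the multiples of 3. Multiplying the column of exponent
    e by z^3 + z^-3 gives those of e + 3 and e - 3, so moving on by two columns is this
    multiplication up to an earlier column. *)
Lemma det_Sp_num n (z : 'rV[K]_n) :
  (forall i, z 0 i != 0) ->
  \det (\matrix_(i, k < n) zdiff (z 0 i) (3 * k./2 + odd k).+1) =
  (\prod_(i < n) sigma (z 0 i)) *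
  \det (interleaved_mx (\row_i (z 0 i ^+ 3 + z 0 i ^- 3))
                       (\row_i (z 0 i + (z 0 i)^-1))).
Proof.
move=> z0; set W := \row_i (_ ^+ 3 + _); set Z := \row_i (_ + _).
pose f k : 'cV[K]_n := \col_i zdiff (z 0 i) (3 * k./2 + odd k).+1.
pose b k : 'cV[K]_n := \col_i (sigma (z 0 i) * (W 0 i ^+ k./2 * Z 0 i ^+ odd k)).
transitivity (\det (\matrix_(i, k < n) f k i 0)).
  by congr (\det _); apply/matrixP => i k; rewrite !mxE.
rewrite (@det_unitriangular _ _ b) => [|k _]; last first.
  apply: (@in_span_recurrence _ _ (diag_mx W) b f 2) => // [m|[|[]] // _|m].
  - by apply/colP => i; rewrite mul_diag_mx !mxE addn2 /= negbK exprS !mulrA [sigma _ * _]mulrC.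
  - by apply/colP => i; rewrite !mxE /zdiff /sigma !mulr1 !expr1.
  - by apply/colP => i; rewrite !mxE /zdiff /sigma /= muln0 add0n mul1r; field; rewrite z0.
  rewrite addn2; case: m => [|[|m]].
  (* For e = 1 and e = 2 the exponent e - 3 is negative; reflecting it flips the sign and exchanges
     the two initial columns. *)
  - rewrite (_ : _ - _ = 1 *: f 1%N); first exact/in_spanZ/in_span_mem.
    by apply/colP => i; rewrite mul_diag_mx !mxE /zdiff /=; field; rewrite z0.
  - rewrite (_ : _ - _ = 1 *: f 0%N); first exact/in_spanZ/in_span_mem.
    by apply/colP => i; rewrite mul_diag_mx !mxE /zdiff /=; field; rewrite z0.
  rewrite (_ : _ - _ = -1 *: f m); first by apply/in_spanZ/in_span_mem; lia.
  apply/colP => i; rewrite mul_diag_mx !mxE /zdiff /= !negbK.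
  rewrite (_ : (3 * (m./2).+2 + odd m).+1 = (3 * m./2 + odd m).+1 + 6)%N; last lia.
  rewrite (_ : (3 * (m./2).+1 + odd m).+1 = (3 * m./2 + odd m).+1 + 3)%N; last lia.
  rewrite !exprD; have := expf_neq0 (3 * m./2 + odd m).+1 (z0 i).
  by move: (_ ^+ (3 * m./2 + odd m).+1) => t t0; field; rewrite z0 t0.
have -> : \prod_(i < n) sigma (z 0 i) = \det (diag_mx (\row_i sigma (z 0 i))).
  by rewrite det_diag; apply: eq_bigr => i _; rewrite mxE.
rewrite -det_mulmx; congr (\det _).
by apply/matrixP => i k; rewrite mul_diag_mx !mxE.
Qed.

(** The same permutation reverses the columns above and below, so its sign cancels; the decreasing
    exponents of the characters become increasing. *)
Lemma det_rev_ratio n (F G : 'I_n -> nat -> K) :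
  \det (\matrix_(i, j < n) F i (n - j.+1)%N) / \det (\matrix_(i, j < n) G i (n - j.+1)%N) =
  \det (\matrix_(i, j < n) F i j) / \det (\matrix_(i, j < n) G i j).
Proof.
pose s : 'S_n := perm (@rev_ord_inj n).
have revE (H : 'I_n -> nat -> K) : \det (\matrix_(i, j < n) H i (n - j.+1)%N) =
    \det (\matrix_(i, j < n) H i j) * (-1) ^+ s.
  rewrite (_ : \matrix_(i, j) _ = col_perm s (\matrix_(i, j < n) H i j)).
    by rewrite col_permE det_mulmx det_perm odd_permV.
  by apply/matrixP => i j; rewrite !mxE permE.
by rewrite !revE -mulf_div divff ?mulr1 // signr_eq0.
Qed.

End Characters.

(** * Staircase indices with doubled entries *)

Lemma perm_cat_double (T : eqType) (s : seq T) :
  perm_eq (s ++ s) (flatten [seq [:: t; t] | t <- s]).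
Proof.
elim: s => //= t s IHs; rewrite perm_cons -cat1s perm_catCA /= perm_cons.
exact: IHs.
Qed.

Lemma nth_flatten_double (T : Type) (t0 : T) (s : seq T) j :
  nth t0 (flatten [seq [:: t; t] | t <- s]) j = nth t0 s j./2.
Proof.
by elim: s j => [|t s IHs] [|[|j]] //=; rewrite ?nth_nil.
Qed.

Lemma sorted_flatten_double (T : Type) (r : rel T) (s : seq T) :
  reflexive r -> sorted r s -> sorted r (flatten [seq [:: t; t] | t <- s]).
Proof.
move=> r_refl; case: s => //= t s; rewrite r_refl /=.
by elim: s t => //= t' s IHs t /andP[-> /IHs ->]; rewrite r_refl.
Qed.

(** Merging two copies of a decreasing sequence repeats each entry twice, whence the index
    [j./2]. *)
Lemma nth_delta_merge d m j : (0 < d)%N -> (j < m.+1 + m.+1)%N ->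
  nth 0%N (delta_merge d (d * m)%N (d * m)%N) j = (d * (m - j./2))%N.
Proof.
move=> d_gt0 lt_jm; rewrite /delta_merge /delta_seq mulKn //.
set s := [seq _ | k <- _].
have -> : sort geq (s ++ s) = flatten [seq [:: t; t] | t <- s].
  have geq_trans : transitive geq by move=> x y z /= yx zy; exact: leq_trans yx.
  apply: (@sorted_eq _ geq) => //.
  - by move=> x y /=; rewrite -eqn_leq => /eqP.
  - by apply: sort_sorted => x y; exact: leq_total.
  - apply: sorted_flatten_double; first exact: leqnn.
    apply: (homo_sorted _ _ (iota_sorted 0 _)) => x y xy /=.
    by rewrite leq_sub2l // leq_mul2l xy orbT.
  by rewrite perm_sort perm_cat_double.
rewrite nth_flatten_double (nth_map 0%N) ?size_iota ?nth_iota; try lia.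
by rewrite add0n mulnBr.
Qed.

(** * The sixth root of unity *)

Section Order6.

Variables (K : fieldType) (n : nat) (x y : 'rV[K]_n) (a : K).
Hypotheses (a0 : a != 0) (sqa : sqsum a = - 1) (K3 : 3 != 0 :> K).
Hypotheses (x0 : forall i, x 0 i != 0) (y0 : forall i, y 0 i != 0).
Hypotheses (sx0 : forall i, sigma (x 0 i ^+ 2) != 0)
           (sy0 : forall i, sigma (y 0 i ^+ 2) != 0).
Hypotheses (x_inj : forall i j, i != j -> sqsum (x 0 i) != sqsum (x 0 j))
           (y_inj : forall i j, i != j -> sqsum (y 0 i) != sqsum (y 0 j))
           (xy : forall i j, sqsum (y 0 j) != sqsum (x 0 i)).
Hypotheses
  (xx_den0 : forall i j, i != j -> UU_den (- 1) (sqsum (x 0 i)) (sqsum (x 0 j)) != 0)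
  (xy_den0 : forall i j, UU_den (- 1) (sqsum (x 0 i)) (sqsum (y 0 j)) != 0).

(** Takes x^2 + x^-2 to x^6 + x^-6. *)
Let chebyshev3 (s : K) : K := s ^+ 3 - 3 * s.

Let chebyshev3B (s t : K) : chebyshev3 t - chebyshev3 s = (t - s) * UU_den (- 1) s t.
Proof. by rewrite /chebyshev3 /UU_den; ring. Qed.

(** Since v - u = (Y - X) D by [chebyshev3B], the entries (b - a) / (v - u) become 1/D, and the
    product of the Y - X cancels against the mixed part of the Vandermonde denominator. *)
Lemma Spchar_delta : (0 < n)%N ->
  Spchar (delta_merge 1 (n%:Z - 1) (n%:Z - 1))
    (row_mx (\row_i x 0 i ^+ 2) (\row_i y 0 i ^+ 2)) =
  (\prod_(i < n) \prod_(j < n) UU_den (- 1) (sqsum (x 0 i)) (sqsum (y 0 j)))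
  * \det (\matrix_(i < n, j < n) (UU_den (- 1) (sqsum (x 0 i)) (sqsum (y 0 j)))^-1)
  / (vdm (sqsum_row x) * vdm (sqsum_row y)).
Proof.
move=> n_gt0; set z := row_mx _ _.
have z0 i : z 0 i != 0.
  by rewrite mxE; case: (splitP i) => i' _; rewrite mxE expf_neq0.
have sz0 : \prod_i sigma (z 0 i) != 0.
  apply/prodf_neq0 => i _; rewrite mxE.
  by case: (splitP i) => i' _; rewrite mxE.
have -> : n%:Z - 1 = Posz (1 * n.-1) by lia.
rewrite /Spchar.
pose F i k := zdiff (z 0 i) (3 * k./2 + odd k).+1.
pose G i k := zdiff (z 0 i) k.+1.
have -> : \matrix_(i < n + n, j < n + n)
    (z 0 i ^+ (n + n - j.+1 + 1) - z 0 i ^- (n + n - j.+1 + 1)) =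
    \matrix_(i, j < n + n) G i (n + n - j.+1)%N.
  by apply/matrixP => i j; rewrite [LHS]mxE [RHS]mxE /G /zdiff addn1.
set A := \matrix_(i, j) _.
have {A}-> : A = \matrix_(i, j < n + n) F i (n + n - j.+1)%N.
  apply/matrixP => i j; rewrite [LHS]mxE [RHS]mxE nth_delta_merge ?prednK //.
  rewrite /F /zdiff; have lt_j := ltn_ord j.
  (* Counted from the last column by k = 2n - 1 - j, the part of the index is floor(k/2) and the
     full exponent floor(k/2) + k + 1. *)
  by rewrite (_ : (_ + _ + 1 = (3 * (n + n - j.+1)./2 + odd (n + n - j.+1)).+1)%N) //; lia.
rewrite det_rev_ratio det_Sp_num // det_Sp_den // -[LHS]mulf_div divff // mul1r.
have -> : \row_i (z 0 i + (z 0 i)^-1) = row_mx (sqsum_row x) (sqsum_row y).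
  apply/rowP => i; rewrite mxE !mxE; case: (splitP i) => i' _; by rewrite !mxE.
pose u := \row_i chebyshev3 (sqsum (x 0 i)).
pose v := \row_i chebyshev3 (sqsum (y 0 i)).
have -> : \row_i (z 0 i ^+ 3 + z 0 i ^- 3) = row_mx u v.
  apply/rowP => i; rewrite mxE !mxE.
  by case: (splitP i) => i' _; rewrite !mxE /chebyshev3 /sqsum; field; rewrite ?x0 ?y0 ?oner_neq0.
have u_inj i j : i != j -> u 0 i != u 0 j.
  move=> ij; rewrite !mxE eq_sym -subr_eq0 chebyshev3B mulf_neq0 ?xx_den0 //.
  by rewrite subr_eq0 eq_sym x_inj.
have uvB i j : v 0 j - u 0 i =
    (sqsum (y 0 j) - sqsum (x 0 i)) * UU_den (- 1) (sqsum (x 0 i)) (sqsum (y 0 j)).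
  by rewrite !mxE chebyshev3B.
have uv i j : v 0 j != u 0 i.
  by rewrite -subr_eq0 uvB mulf_neq0 // subr_eq0 xy.
rewrite det_interleaved_cauchy // vdm_row_mx.
set P := \prod_(i < n) \prod_(j < n) UU_den _ _ _.
set Q := \prod_(j < n) \prod_(i < n) (sqsum_row y 0 j - sqsum_row x 0 i).
have -> : \prod_(j < n) \prod_(i < n) (v 0 j - u 0 i) = Q * P.
  rewrite /P [X in _ = _ * X]exchange_big -big_split; apply: eq_bigr => j _; rewrite -big_split.
  by apply: eq_bigr => i _; rewrite uvB !mxE.
have -> : \matrix_(j < n, i < n) ((sqsum_row y 0 j - sqsum_row x 0 i) / (v 0 j - u 0 i))
    = (\matrix_(i < n, j < n) (UU_den (- 1) (sqsum (x 0 i)) (sqsum (y 0 j)))^-1)^T.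
  apply/matrixP => j i; rewrite mxE uvB !mxE invfM mulrA divff ?mul1r //.
  by rewrite subr_eq0 xy.
rewrite det_tr.
have Q0 : Q != 0.
  by apply/prodf_neq0 => j _; apply/prodf_neq0 => i _; rewrite !mxE subr_eq0 xy.
rewrite [vdm _ * vdm _ * Q]mulrC -[Q * P * _]mulrA -[LHS]mulf_div divff // mul1r.
by [].
Qed.

(** For c = -1 the numerator is -(Y + 1), a pure column factor; it yields the product over the y_i,
    and c - 2 = -3 yields the power of 3. *)
Lemma A2_VHP_order6 : (0 < n)%N ->
  A2_VHP x y a =
    3 ^- (n ^ 2)
    * (\prod_(i < n) (y 0 i ^+ 2 + 1 + y 0 i ^- 2))
    * Spchar (delta_merge 1 (n%:Z - 1) (n%:Z - 1))
        (row_mx (\row_i x 0 i ^+ 2) (\row_i y 0 i ^+ 2)).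
Proof.
move=> n_gt0; rewrite Spchar_delta //.
have sqa3 : - 1 - 2 = -1 * 3 :> K by ring.
have sa0 : sigma a != 0.
  by rewrite -sqrf_eq0 sqr_sigma // sqa sqa3 mulN1r oppr_eq0.
rewrite A2_VHP_det ?sqa //; set C := \matrix_(i, j) (_ / _).
set D := \matrix_(i, j) _^-1.
have -> : C = -1 *: (D *m diag_mx (\row_j (sqsum (y 0 j) + 1))).
  by apply/matrixP => i j; rewrite mul_mx_diag !mxE /UU_num; ring.
rewrite detZ det_mulmx det_diag sqa3 exprMn sign_sqr.
under eq_bigr => i _ do rewrite mxE.
under [\prod_(i < n) (y 0 i ^+ 2 + 1 + _)]eq_bigr => i _ do
  rewrite addrAC.
have sgn0 : (-1) ^+ n != 0 :> K by rewrite signr_eq0.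
have pow0 : 3 ^+ (n ^ 2) != 0 :> K by rewrite expf_neq0.
move: (vdm _ * vdm _)^-1 => V.
by field; rewrite sgn0 pow0 ?oner_neq0.
Qed.

End Order6.

(** * The eighth root of unity *)

Section Order8Lemmas.

Variable K : fieldType.

Lemma prod_signS n : \prod_(k < n) (-1) ^+ k.+1 = (-1) ^+ n * pairs_sign K n.
Proof.
under eq_bigr => k _ do rewrite exprS.
rewrite big_split /= prodr_const card_ord; congr (_ * _).
rewrite /pairs_sign (exchange_big_dep xpredT) //=; apply: eq_bigr => j _.
by rewrite -(big_ord_widen _ (fun=> -1) (ltnW (ltn_ord j))) prodr_const card_ord.
Qed.

Lemma det_block_diag n (p q r s : 'rV[K]_n) : (forall i, p 0 i != 0) ->
  \det (block_mx (diag_mx p) (diag_mx q) (diag_mx r) (diag_mx s)) =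
  \prod_(i < n) (p 0 i * s 0 i - q 0 i * r 0 i).
Proof.
move=> p0.
have elim_r : block_mx 1%:M 0 (- diag_mx (\row_i (r 0 i / p 0 i))) 1%:M
      *m block_mx (diag_mx p) (diag_mx q) (diag_mx r) (diag_mx s) =
    block_mx (diag_mx p) (diag_mx q)
             0 (diag_mx (\row_i (s 0 i - r 0 i / p 0 i * q 0 i))).
  rewrite mulmx_block !mul1mx !mul0mx !addr0 !mulNmx !mulmx_diag.
  congr block_mx; apply/matrixP => i j; rewrite !mxE.
    by rewrite divfK // addNr.
  by rewrite mulrnBl addrC.
have := congr1 (fun M => \det M) elim_r.
rewrite det_mulmx det_lblock !det1 !mul1r det_ublock !det_diag => ->.
rewrite -big_split; apply: eq_bigr => i _; rewrite mxE /=.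
by field; rewrite p0.
Qed.

(* With w = x^8, the power (x^4 + x^-4)^k is w^(-k/2) (1 + w)^k for even k, and
   x^-4 w^(-(k-1)/2) (1 + w)^k for odd k.  Multiplying the factors in w by
   w^((n-1)/2) gives polynomials of degree < n; their coefficients are the
   columns of this matrix. *)
Definition pascal_mx n : 'M[K]_n :=
  \matrix_(j, k < n) ('X^(n.-1./2 - k./2) * (1 + 'X) ^+ k : {poly K})`_j.

Lemma size_expr1DX k : size ((1 + 'X : {poly K}) ^+ k) = k.+1.
Proof. by rewrite addrC -[1]opprK -polyCN size_exp_XsubC. Qed.

Lemma lead_coef_expr1DX k : ((1 + 'X : {poly K}) ^+ k)`_k = 1.
Proof.
have := lead_coef_exp ('X - (-1)%:P : {poly K}) k.
by rewrite lead_coefE size_exp_XsubC lead_coefXsubC expr1n polyCN opprK addrC.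
Qed.

(** Expansion along one row leaves the matrix of the next smaller size up to sign. The square is
    free of cofactor signs, and it is what two diagonal copies of the matrix contribute. *)
Lemma det_pascal_sqr n : \det (pascal_mx n) ^+ 2 = 1.
Proof.
elim: n => [|n IHn]; first by rewrite det_mx00 expr1n.
have cofactor_sqr (A : 'M[K]_n.+1) i : A i ord_max = 1 ->
    (forall j, j != ord_max -> A i j = 0) -> row' i (col' ord_max A) = pascal_mx n ->
    \det A ^+ 2 = 1.
  move=> A1 A0 minorE; rewrite (expand_det_row A i) (bigD1 ord_max) //=.
  rewrite A1 mul1r big1 ?addr0 => [|j /A0 ->]; last by rewrite mul0r.
  by rewrite /cofactor minorE exprMn sqrr_sign mul1r IHn.
have [n_odd|n_even] := boolP (odd n).
  (* For odd n only the last column reaches degree n. *)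
  apply: (cofactor_sqr _ ord_max).
  - by rewrite mxE /= subnn expr0 mul1r lead_coef_expr1DX.
  - move=> j jn; have {jn} lt_jn : (j < n)%N.
      by have := ltn_ord j; rewrite ltnS leq_eqVlt -val_eqE /= in jn *; rewrite (negbTE jn).
    rewrite mxE nth_default // (leq_trans (size_polyMleq _ _)) // size_polyXn size_expr1DX.
    by rewrite /=; lia.
  apply/matrixP => i j; rewrite !mxE !lift_max.
  by rewrite (_ : n.+1.-1./2 = n.-1./2); last lia.
(* For even n every column but the last is divisible by X; removing one X from each gives the
   smaller matrix. *)
apply: (cofactor_sqr _ ord0).
- by rewrite mxE /= subnn expr0 mul1r -horner_coef0 horner_exp hornerD hornerC hornerX addr0 expr1n.
- move=> j jn; have {jn} lt_jn : (j < n)%N.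
    by have := ltn_ord j; rewrite ltnS leq_eqVlt -val_eqE /= in jn *; rewrite (negbTE jn).
  by rewrite mxE coefXnM /= ifT //; lia.
apply/matrixP => i j; rewrite !mxE lift_max lift0 /=.
have lt_j := ltn_ord j.
rewrite (_ : (n./2 - j./2 = (n.-1./2 - j./2).+1)%N); last lia.
by rewrite exprS -mulrA coefXM.
Qed.

Lemma mul_pascal_mx n (w : 'rV[K]_n) i k :
  (powers_mx w *m pascal_mx n) i k = w 0 i ^+ (n.-1./2 - k./2) * (1 + w 0 i) ^+ k.
Proof.
transitivity (('X^(n.-1./2 - k./2) * (1 + 'X) ^+ k : {poly K}).[w 0 i]); last first.
  by rewrite hornerM hornerXn horner_exp hornerD hornerC hornerX.
rewrite (@horner_coef_wide _ n).
  by rewrite mxE; apply: eq_bigr => j _; rewrite !mxE mulrC.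
rewrite (leq_trans (size_polyMleq _ _)) // size_polyXn size_expr1DX.
by have := ltn_ord k; rewrite /=; lia.
Qed.

Let quartic (t : K) : K := sqsum t ^+ 2 - 2.

(** 1 + t^8 = t^4 (t^4 + t^-4), and the power of t left over has exponent 4k - 8 floor(k/2). *)
Lemma pascal_quartic (t : K) n k : t != 0 -> (k < n)%N ->
  (t ^+ 8) ^- n.-1./2 * ((t ^+ 8) ^+ (n.-1./2 - k./2) * (1 + t ^+ 8) ^+ k) =
  t ^+ (4 * odd k) * quartic t ^+ k.
Proof.
move=> t0 lt_kn; have le_km : (k./2 <= n.-1./2)%N by lia.
rewrite (_ : 1 + t ^+ 8 = t ^+ 4 * quartic t); last first.
  by rewrite /quartic /sqsum; field; rewrite t0.
rewrite (exprMn _ (t ^+ 4)) !mulrA; congr (_ * _).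
have w0 m : (t ^+ 8) ^+ m != 0 by rewrite !expf_neq0.
apply: (mulfI (w0 n.-1./2)); rewrite !mulrA divff // mul1r -!exprM -!exprD.
by congr (_ ^+ _); lia.
Qed.

(** With q = t^4 + t^-4 the two left sides are 2 t q^k and 2 t^-1 q^k for even k, and 2 t^3 q^k and
    2 t^5 q^k for odd k. Parity thus decides which of them carries the extra factor t^2. *)
Lemma quartic_rows (t : K) n k : t != 0 -> (k < n)%N ->
  let c := 2 * t^-1 * (t ^+ 8) ^- n.-1./2 in
  let g := (t ^+ 8) ^+ (n.-1./2 - k./2) * (1 + t ^+ 8) ^+ k in
  (t + t ^+ 3) * quartic t ^+ k + (t - t ^+ 3) * (- quartic t) ^+ k =
    c * (g * (odd k)%:R + t ^+ 2 * g * (~~ odd k)%:R)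
  /\ (t + t ^+ 3) * ((sqsum t - 1) * quartic t ^+ k)
     + (t - t ^+ 3) * ((sqsum t + 1) * (- quartic t) ^+ k) =
    c * (g * (~~ odd k)%:R + t ^+ 2 * g * (odd k)%:R).
Proof.
move=> t0 lt_kn c g.
have cgE : c * g = 2 * t^-1 * (t ^+ (4 * odd k) * quartic t ^+ k).
  by rewrite -(pascal_quartic t0 lt_kn) mulrA.
clearbody c g; have expand b b' :
    c * (g * b + t ^+ 2 * g * b') = c * g * b + t ^+ 2 * (c * g) * b'.
  by ring.
rewrite !expand cgE exprNn -signr_odd; move: (quartic t ^+ k) => q.
by rewrite /sqsum; case: (odd k); rewrite /= ?muln1 ?muln0; split; field; rewrite t0.
Qed.

(** Row combination by [L] turns the matrix into a row scaling times the matrix in x^8 and x^-8, two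
    diagonal copies of the Pascal matrix, and [S], which exchanges columns k and n + k for even
    k. *)
Lemma det_twisted_quartic n (x : 'rV[K]_n) :
  (forall i, x 0 i != 0) -> (forall i, sigma (x 0 i ^+ 2) != 0) -> 2 != 0 :> K ->
  let X := sqsum_row x in
  let U := \row_i quartic (x 0 i) in
  let z := \row_i x 0 i ^+ 2 in
  let zV := \row_i (x 0 i)^-1 ^+ 2 in
  let w := \row_i x 0 i ^+ 8 in
  let wV := \row_i (x 0 i)^-1 ^+ 8 in
  (\prod_(i < n) sigma (x 0 i ^+ 2)) *
  \det (twisted_powers_mx U (- U) (X - const_mx 1) (X + const_mx 1)) =
  2 ^+ n * ((-1) ^+ n * pairs_sign K n) * \det (twisted_powers_mx w wV z zV).
Proof.
move=> x0 sx0 K2 X U z zV w wV.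
pose xV : 'rV[K]_n := \row_i (x 0 i)^-1.
pose add3 (t : 'rV[K]_n) := \row_i (t 0 i + t 0 i ^+ 3).
pose sub3 (t : 'rV[K]_n) := \row_i (t 0 i - t 0 i ^+ 3).
pose scale (t : 'rV[K]_n) := \row_i (2 * (t 0 i)^-1 * (t 0 i ^+ 8) ^- n.-1./2).
pose odds : 'rV[K]_n := \row_k (odd k)%:R.
pose evens : 'rV[K]_n := \row_k (~~ odd k)%:R.
pose L := block_mx (diag_mx (add3 x)) (diag_mx (sub3 x))
                   (diag_mx (add3 xV)) (diag_mx (sub3 xV)).
pose S := block_mx (diag_mx odds) (diag_mx evens) (diag_mx evens) (diag_mx odds).
pose T := pascal_mx n.
have detL : \det L = 2 ^+ n * \prod_(i < n) sigma (x 0 i ^+ 2).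
  rewrite det_block_diag => [|i].
    rewrite -[n in 2 ^+ n]card_ord -prodr_const -big_split.
    apply: eq_bigr => i _; rewrite !mxE /sigma /=.
    by field; rewrite x0.
  (* The pivot x + x^3 is a factor of sigma(x^2), hence nonzero. *)
  rewrite mxE; apply: contra_neq (sx0 i) => e0.
  have -> : sigma (x 0 i ^+ 2) = (x 0 i + x 0 i ^+ 3) * (x 0 i - (x 0 i)^-1) * x 0 i ^- 2.
    by rewrite /sigma; field; rewrite x0.
  by rewrite e0 !mul0r.
have detS : \det S = (-1) ^+ n * pairs_sign K n.
  (* The parity indicators add up to 1, so adding the lower block row makes every pivot 1. *)
  have addS : block_mx 1%:M 1%:M 0 1%:M *m S =
      block_mx (diag_mx (const_mx 1)) (diag_mx (const_mx 1)) (diag_mx evens) (diag_mx odds).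
    rewrite mulmx_block !mul1mx !mul0mx !add0r -!linearD /=.
    by congr (block_mx (diag_mx _) (diag_mx _)); apply/rowP => k; rewrite !mxE;
      case: (odd k); rewrite /= ?addr0 ?add0r.
  have := congr1 (fun M => \det M) addS.
  rewrite det_mulmx det_ublock !det1 !mul1r [X in _ = X -> _]det_block_diag => [->|i]; last first.
    by rewrite mxE oner_neq0.
  rewrite -prod_signS; apply: eq_bigr => k _; rewrite !mxE exprS -signr_odd.
  by case: (odd k); rewrite /= ?expr0 ?expr1; ring.
have rowsE : L *m twisted_powers_mx U (- U) (X - const_mx 1) (X + const_mx 1) =
    block_mx (diag_mx (scale x)) 0 0 (diag_mx (scale xV)) *m
    (twisted_powers_mx w wV z zV *m block_mx T 0 0 T *m S).
  (* t = x and t = 1/x share the value t^2 + t^-2, so one computation serves both block rows. *)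
  have halfE (t : 'rV[K]_n) : (forall i, t 0 i != 0) -> (forall i, sqsum (t 0 i) = X 0 i) ->
      let w' := \row_i t 0 i ^+ 8 in let z' := \row_i t 0 i ^+ 2 in
      diag_mx (add3 t) *m powers_mx U + diag_mx (sub3 t) *m powers_mx (- U) =
        diag_mx (scale t) *m (powers_mx w' *m T *m diag_mx odds
                             + diag_mx z' *m (powers_mx w' *m T) *m diag_mx evens)
      /\ diag_mx (add3 t) *m (diag_mx (X - const_mx 1) *m powers_mx U)
         + diag_mx (sub3 t) *m (diag_mx (X + const_mx 1) *m powers_mx (- U)) =
        diag_mx (scale t) *m (powers_mx w' *m T *m diag_mx evens
                             + diag_mx z' *m (powers_mx w' *m T) *m diag_mx odds).
    move=> t0 tX w' z'.
    have UE i : U 0 i = quartic (t 0 i) by rewrite mxE /quartic tX mxE.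
    have diagl (d : 'rV[K]_n) (A : 'M[K]_n) i k : (diag_mx d *m A) i k = d 0 i * A i k.
      by rewrite mul_diag_mx mxE.
    have diagr (d : 'rV[K]_n) (A : 'M[K]_n) i k : (A *m diag_mx d) i k = A i k * d 0 k.
      by rewrite mul_mx_diag mxE.
    have addE (A B : 'M[K]_n) i k : (A + B) i k = A i k + B i k by rewrite mxE.
    have pE i k : (powers_mx w' *m T) i k =
        (t 0 i ^+ 8) ^+ (n.-1./2 - k./2) * (1 + t 0 i ^+ 8) ^+ k.
      by rewrite mul_pascal_mx mxE.
    have [uE nuE] : (forall i k, powers_mx U i k = quartic (t 0 i) ^+ k) /\
        (forall i k, powers_mx (- U) i k = (- quartic (t 0 i)) ^+ k).
      by split=> i k; rewrite mxE ?[(- U) 0 i]mxE UE.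
    split; apply/matrixP => i k; have [e1 e2] := quartic_rows (t0 i) (ltn_ord k);
      rewrite !(addE, diagl, diagr) !pE uE nuE.
      by move: e1; rewrite !mxE => ->.
    have -> : (X - const_mx 1) 0 i = sqsum (t 0 i) - 1 by rewrite tX !mxE.
    have -> : (X + const_mx 1) 0 i = sqsum (t 0 i) + 1 by rewrite tX !mxE.
    by move: e2; rewrite !mxE => ->.
  have xP i : xV 0 i = (x 0 i)^-1 by rewrite mxE.
  have [] := halfE x x0; first by move=> i; rewrite [RHS]mxE.
  rewrite -/w -/z => h11 h12.
  have [] := halfE xV.
  - by move=> i; rewrite xP invr_neq0.
  - by move=> i; rewrite xP [RHS]mxE /sqsum !exprVn invrK addrC.
  have -> : \row_i xV 0 i ^+ 8 = wV by apply/rowP => i; rewrite !mxE.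
  have -> : \row_i xV 0 i ^+ 2 = zV by apply/rowP => i; rewrite !mxE.
  move=> h21 h22.
  rewrite /L /twisted_powers_mx !mulmx_block h11 h12 h21 h22 !(mulmx0, mul0mx, addr0, add0r).
  by rewrite -!mulmxA.
have det_scale : \det (block_mx (diag_mx (scale x)) 0 0 (diag_mx (scale xV))) = 2 ^+ n * 2 ^+ n.
  rewrite det_ublock !det_diag -big_split -exprMn -[n in RHS]card_ord -prodr_const.
  apply: eq_bigr => i _; rewrite !mxE /= !exprVn !invrK.
  have := expf_neq0 n.-1./2 (expf_neq0 8 (x0 i)); move: (_ ^+ n.-1./2) => u u0.
  by field; rewrite x0 u0.
have := congr1 (fun M => \det M) rowsE.
have detT2 : \det T * \det T = 1 by rewrite -expr2 det_pascal_sqr.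
rewrite !det_mulmx detL detS det_scale (det_ublock T) detT2 mulr1.
have pow0 : 2 ^+ n != 0 :> K by rewrite expf_neq0.
move=> e; apply: (mulfI pow0); rewrite [LHS]mulrA e; ring.
Qed.

End Order8Lemmas.

(** * The case y = x and the general linear character *)

Section Order8.

Variables (K : fieldType) (n : nat) (x : 'rV[K]_n) (a : K).
Hypotheses (a0 : a != 0) (sqa : sqsum a = 0) (K2 : 2 != 0 :> K).
Hypotheses (x0 : forall i, x 0 i != 0) (sx0 : forall i, sigma (x 0 i ^+ 2) != 0).
Hypotheses (x_inj : forall i j, i != j -> sqsum (x 0 i) != sqsum (x 0 j))
           (xx0 : forall i j, i != j -> sqsum (x 0 i) + sqsum (x 0 j) != 0)
           (xx_den0 : forall i j, UU_den 0 (sqsum (x 0 i)) (sqsum (x 0 j)) != 0).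

Let z : 'rV[K]_n := \row_i x 0 i ^+ 2.
Let zV : 'rV[K]_n := \row_i (x 0 i)^-1 ^+ 2.

(** For i < j the four factors multiply to -(X_j - X_i)^2; the diagonal ones x_i^-2 - x_i^2 are
    -sigma(x_i^2). *)
Lemma vdm_reciprocal :
  vdm (row_mx z zV) =
  (-1) ^+ n * (\prod_(i < n) sigma (x 0 i ^+ 2)) * pairs_sign K n
  * vdm (sqsum_row x) ^+ 2.
Proof.
rewrite vdm_row_mx prod_pairs; set A := \prod_(i < n) (_ - _); set B := \prod_i \prod_(j | _) _.
have -> : A = (-1) ^+ n * \prod_(i < n) sigma (x 0 i ^+ 2).
  rewrite -[n in (-1) ^+ n]card_ord -prodr_const -big_split.
  by apply: eq_bigr => i _; rewrite !mxE /sigma /=; field; rewrite x0.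
have -> : (-1) ^+ n * (\prod_(i < n) sigma (x 0 i ^+ 2)) * pairs_sign K n
    * vdm (sqsum_row x) ^+ 2 =
    (-1) ^+ n * (\prod_(i < n) sigma (x 0 i ^+ 2))
    * (pairs_sign K n * vdm (sqsum_row x) ^+ 2) by rewrite !mulrA.
suff <- : vdm z * vdm zV * B = pairs_sign K n * vdm (sqsum_row x) ^+ 2 by ring.
rewrite expr2 -!big_split; apply: eq_bigr => i _; rewrite -!big_split.
apply: eq_bigr => j _; rewrite !mxE /sqsum /=.
by field; rewrite !x0 ?oner_neq0.
Qed.

(** With k = 2n - 1 - j the exponent is 2 floor(k/2) + k = 4 floor(k/2) + (k mod 2). In the
    variables x^2 and x^-2 this means powers of x^8 and x^-8 with at most one further factor. *)
Lemma GLchar_delta : (0 < n)%N ->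
  GLchar (delta_merge 2 (2 * n%:Z - 2) (2 * n%:Z - 2))
    (row_mx (\row_i x 0 i ^+ 2) (\row_i x 0 i ^- 2)) =
  (-1) ^+ n * \det (twisted_powers_mx (\row_i x 0 i ^+ 8) (\row_i (x 0 i)^-1 ^+ 8) z zV)
  / ((\prod_(i < n) sigma (x 0 i ^+ 2)) * vdm (sqsum_row x) ^+ 2).
Proof.
move=> n_gt0.
have -> : row_mx (\row_i x 0 i ^+ 2) (\row_i x 0 i ^- 2) = row_mx z zV.
  by congr row_mx; apply/rowP => i; rewrite !mxE exprVn.
have -> : 2 * n%:Z - 2 = Posz (2 * n.-1) by lia.
rewrite /GLchar; set t := row_mx _ _.
pose F i k := t 0 i ^+ (4 * k./2 + odd k).
pose G i k := t 0 i ^+ k.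
have -> : \matrix_(i < n + n, j < n + n) t 0 i ^+ (n + n - j.+1) =
    \matrix_(i, j < n + n) G i (n + n - j.+1)%N.
  by apply/matrixP => i j; rewrite [LHS]mxE [RHS]mxE.
set A := \matrix_(i, j) _.
have {A}-> : A = \matrix_(i, j < n + n) F i (n + n - j.+1)%N.
  apply/matrixP => i j; rewrite [LHS]mxE [RHS]mxE nth_delta_merge ?prednK // /F.
  by have lt_j := ltn_ord j; congr (_ ^+ _); lia.
rewrite det_rev_ratio.
have -> : \matrix_(i, j < n + n) G i j = powers_mx t by [].
rewrite det_powers_mx vdm_reciprocal det_interleaved.
have -> : \matrix_(i, j < n + n) F i j =
    interleaved_mx (row_mx (\row_i x 0 i ^+ 8) (\row_i (x 0 i)^-1 ^+ 8)) t.
  apply/matrixP => i k; rewrite [LHS]mxE [RHS]mxE /F exprD exprM; congr (_ ^+ _ * _).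
  by rewrite !mxE; case: splitP => i' _; rewrite !mxE -exprM.
have V0 : vdm (sqsum_row x) != 0.
  by apply: vdm_neq0 => i j ij; rewrite !mxE x_inj.
have s0 : \prod_(i < n) sigma (x 0 i ^+ 2) != 0 by apply/prodf_neq0 => i _.
have := pairs_sign_sqr K n; set e := pairs_sign K n => ee.
have e0 : e != 0 by apply/eqP => e0; move/eqP: ee; rewrite e0 mul0r eq_sym oner_eq0.
have gg : (-1) ^+ n * (-1) ^+ n = 1 :> K by rewrite -expr2 sqrr_sign.
move: ((-1) ^+ n) gg => g gg.
have g0 : g != 0 by apply/eqP => g0; move/eqP: gg; rewrite g0 mul0r eq_sym oner_eq0.
move: (\prod_(i < n) _) s0 => s s0; move: (vdm _) V0 => V V0.
move: (\det _) => D.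
have -> : g * (e * D) = e / g * D by apply: (mulfI g0); rewrite !mulrA gg; field.
by field : ee; rewrite e0 g0 V0 s0.
Qed.

Lemma A2_VHP_order8 : (0 < n)%N ->
  A2_VHP x x a =
    2 ^ (- (n%:Z ^+ 2) + n%:Z)
    * GLchar (delta_merge 2 (2 * n%:Z - 2) (2 * n%:Z - 2))
        (row_mx (\row_i x 0 i ^+ 2) (\row_i x 0 i ^- 2)).
Proof.
move=> n_gt0; rewrite GLchar_delta //.
have sqa2 : 0 - 2 = -1 * 2 :> K by ring.
have sa0 : sigma a != 0.
  by rewrite -sqrf_eq0 sqr_sigma // sqa sqa2 mulN1r oppr_eq0.
rewrite A2_VHP_det ?sqa //; set C := \matrix_(i, j) (_ / _).
pose X := sqsum_row x.
pose U := \row_i (sqsum (x 0 i) ^+ 2 - 2).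
(* For c = 0, v - u and b - a are the negatives of D and of the numerator, so the entries are (b -
   a) / (v - u); here y = x makes v = -u. *)
have UB i j : (- U) 0 j - U 0 i = -1 * UU_den 0 (sqsum (x 0 i)) (sqsum (x 0 j)).
  by rewrite !mxE /UU_den; ring.
have U_inj i j : i != j -> U 0 i != U 0 j.
  move=> ij; rewrite -subr_eq0 !mxE.
  rewrite (_ : _ - _ = (sqsum (x 0 i) - sqsum (x 0 j)) * (sqsum (x 0 i) + sqsum (x 0 j))).
    by rewrite mulf_neq0 ?xx0 // subr_eq0 x_inj.
  by ring.
have UU i j : (- U) 0 j != U 0 i.
  by rewrite -subr_eq0 UB mulN1r oppr_eq0.
have := det_twisted_powers (X - const_mx 1) (X + const_mx 1) U_inj UU.
have -> : \matrix_(j < n, i < n) (((X + const_mx 1) 0 j - (X - const_mx 1) 0 i)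
    / ((- U) 0 j - U 0 i)) = C^T.
  apply/matrixP => j i; rewrite mxE UB !mxE /UU_num.
  by rewrite mulN1r invrN mulrN -mulNr; congr (_ / _); ring.
rewrite det_tr; set P := \prod_(i < n) \prod_(j < n) UU_den _ _ _.
have -> : \prod_(j < n) \prod_(i < n) ((- U) 0 j - U 0 i) = (-1) ^+ n * P.
  transitivity (\prod_(j < n) \prod_(i < n)
      (-1 * UU_den 0 (sqsum (x 0 i)) (sqsum (x 0 j)))).
    by apply: eq_bigr => j _; apply: eq_bigr => i _; rewrite UB.
  under eq_bigr => j _ do rewrite big_split /= prodr_const card_ord.
  rewrite big_split /= prodr_const card_ord -exprM mulnn sign_sqr.
  by rewrite /P [in RHS]exchange_big.
have := det_twisted_quartic x0 sx0 K2; cbv zeta.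
set V := \det (twisted_powers_mx _ _ _ _); set D := \det (twisted_powers_mx _ _ _ _).
move=> VD VC.
have s0 : \prod_(i < n) sigma (x 0 i ^+ 2) != 0 by apply/prodf_neq0 => i _.
(* Two evaluations of the determinant [V] are compared; the signs in them square to 1. *)
have PC : P * \det C = 2 ^+ n * D / \prod_(i < n) sigma (x 0 i ^+ 2).
  apply: (mulfI s0); rewrite [RHS]mulrC divfK //.
  have := pairs_sign_sqr K n; move: (pairs_sign K n) VC VD => e VC VD ee.
  have := sqrr_sign K n; rewrite expr2; move: ((-1) ^+ n) VC VD => g VC VD gg.
  have eg2 : e * g * (e * g) = 1 by rewrite mulrACA ee gg mulr1.
  have -> : P * \det C = e * g * V.
    by rewrite VC -[LHS]mul1r -eg2; ring.
  by rewrite mulrCA VD -[RHS]mul1r -eg2; ring.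
rewrite sqa2 exprMn sign_sqr -[_ * P * _]mulrA PC.
have -> : 2 ^ (- (n%:Z ^+ 2) + n%:Z) = 2 ^- (n ^ 2) * 2 ^+ n :> K.
  rewrite expfzDr // -exprnP; congr (_ * _).
  by rewrite exprnN; congr (_ ^ (- _)); rewrite -[n%:Z]natz -natrX natz.
have V0 : vdm (sqsum_row x) != 0.
  by apply: vdm_neq0 => i j ij; rewrite !mxE x_inj.
have := sqrr_sign K n; rewrite expr2; move: ((-1) ^+ n) => g gg.
have g0 : g != 0 by apply/eqP => g0; move/eqP: gg; rewrite g0 mul0r eq_sym oner_eq0.
have -> : (g * 2 ^+ (n ^ 2))^-1 = g * 2 ^- (n ^ 2).
  by rewrite invfM; congr (_ * _); apply: (mulfI g0); rewrite divff.
have pow0 : 2 ^+ (n ^ 2) != 0 :> K by rewrite expf_neq0.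
by field; rewrite V0 s0 pow0.
Qed.

End Order8.

(** * Specialization to roots of unity and indeterminates *)

Section RootsOfUnity.

Variable R : realType.

Lemma expr_cis (t : R) k :
  (Complex (cos t) (sin t)) ^+ k = Complex (cos (t *+ k)) (sin (t *+ k)).
Proof.
elim: k => [|k IHk]; first by rewrite expr0 mulr0n cos0 sin0.
rewrite exprS IHk mulrS cosD sinD; apply/eqP; rewrite eq_complex /=.
by rewrite eqxx addrC [cos t * _]mulrC eqxx.
Qed.

Lemma zeta_expr_half m : (0 < m)%N -> zeta R (2 * m) ^+ m = -1.
Proof.
move=> m_gt0; have m0 : m%:R != 0 :> R by rewrite pnatr_eq0 -lt0n.
rewrite /zeta expr_cis.
have -> : pi *+ 2 / (2 * m)%:R *+ m = pi :> R.
  rewrite -[_ *+ m]mulr_natr -[pi *+ 2]mulr_natr mulrAC -(mulrA pi) -natrM mulfK //.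
  by rewrite natrM mulf_neq0 // pnatr_eq0.
by rewrite cospi sinpi; apply/eqP; rewrite eq_complex /= oppr0 !eqxx.
Qed.

(** zeta^3 = -1 leaves zeta = -1 or the quadratic equation; the imaginary part sin(pi/3) > 0
    excludes the former. *)
Lemma zeta6_minpoly : zeta R 6 ^+ 2 - zeta R 6 + 1 = 0.
Proof.
have z3 : zeta R 6 ^+ 3 = -1 := @zeta_expr_half 3 isT.
have : (zeta R 6 + 1) * (zeta R 6 ^+ 2 - zeta R 6 + 1) = 0.
  by transitivity (zeta R 6 ^+ 3 + 1); [ring | rewrite z3 addNr].
move/eqP; rewrite mulf_eq0 => /orP[/eqP z1|/eqP//].
have : sin (pi *+ 2 / 6%:R) = 0 :> R by have := congr1 (@complex.Im R) z1; rewrite /= addr0.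
move/eqP; rewrite gt_eqF // sin_gt0_pi //; have := pi_gt0 R => pi0.
apply/andP; split; first by rewrite divr_gt0 // pmulrn_lgt0.
by rewrite ltr_pdivrMr // -[pi *+ 2]mulr_natr ltr_pM2l // ltr_nat.
Qed.

End RootsOfUnity.

(** * Values and factorizations of t^2 + t^-2 *)

Section SqsumRoots.

Variables (K : fieldType) (a : K).

Lemma sqsum_order4 : a ^+ 2 = -1 -> sqsum a = - 2.
Proof. by move=> a2; rewrite /sqsum a2 invrN1; ring. Qed.

Lemma sqsum_order6 : a ^+ 2 - a + 1 = 0 -> sqsum a = - 1.
Proof.
move=> a2; have aV : a^-1 = 1 - a.
  have a1 : a * (1 - a) = 1 by rewrite -[RHS]subr0 -a2; ring.
  have a0 : a != 0 by apply: contra_eq_neq a1 => ->; rewrite mul0r eq_sym oner_neq0.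
  by apply: (mulfI a0); rewrite divff.
by rewrite /sqsum -exprVn aV -[RHS]addr0 -[0](mulr0 2) -a2; ring.
Qed.

Lemma sqsum_order8 : a ^+ 4 = -1 -> sqsum a = 0.
Proof.
move=> a4; have a0 : a ^+ 2 != 0.
  apply: contra_eq_neq a4; rewrite (exprM a 2 2) => ->.
  by rewrite expr0n eq_sym oppr_eq0 oner_neq0.
by apply: (mulfI a0); rewrite /sqsum mulrDr divff // -exprD a4 mulr0 addNr.
Qed.

End SqsumRoots.

Section SqsumFactorizations.

Variables (K : fieldType) (s t : K).
Hypotheses (s0 : s != 0) (t0 : t != 0).

(** Like the factorizations that follow, this isolates a polynomial numerator, whose nonvanishing
    can be tested at a point. *)
Lemma sigma_sqrE : sigma (s ^+ 2) = (s ^+ 4 - 1) / s ^+ 2.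
Proof. by rewrite /sigma; field; rewrite s0. Qed.

Lemma sqsumBE :
  sqsum s - sqsum t = (s ^+ 2 - t ^+ 2) * (s ^+ 2 * t ^+ 2 - 1) / (s ^+ 2 * t ^+ 2).
Proof. by rewrite /sqsum; field; rewrite s0 t0. Qed.

Lemma sqsumDE :
  sqsum s + sqsum t = (s ^+ 2 + t ^+ 2) * (1 + s ^+ 2 * t ^+ 2) / (s ^+ 2 * t ^+ 2).
Proof. by rewrite /sqsum; field; rewrite s0 t0. Qed.

Lemma UU_den6E : UU_den (- 1) (sqsum s) (sqsum t) =
  (s ^+ 4 + s ^+ 2 * t ^+ 2 + t ^+ 4) * (1 + s ^+ 2 * t ^+ 2 + s ^+ 4 * t ^+ 4)
  / (s ^+ 4 * t ^+ 4).
Proof. by rewrite /UU_den /sqsum; field; rewrite s0 t0. Qed.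

Lemma UU_den8E : UU_den 0 (sqsum s) (sqsum t) =
  (s ^+ 4 + t ^+ 4) * (1 + s ^+ 4 * t ^+ 4) / (s ^+ 4 * t ^+ 4).
Proof. by rewrite /UU_den /sqsum; field; rewrite s0 t0. Qed.

End SqsumFactorizations.

(* f is the embedding of a ring A into its field of fractions; since f p is
   nonzero as soon as g p is, nonvanishing is tested at the point given by g. *)
Section Specialization.

Variables (A : comNzRingType) (K : fieldType) (C : numDomainType).
Variables (f : {rmorphism A -> K}) (g : {rmorphism A -> C}).
Hypothesis neq0_fg : forall p, g p != 0 -> f p != 0.

Lemma natr_specialize_neq0 m : (0 < m)%N -> m%:R != 0 :> K.
Proof.
move=> m_gt0; rewrite -(rmorph_nat f); apply: neq0_fg.
by rewrite rmorph_nat pnatr_eq0 -lt0n.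
Qed.

Section Point.

Variables (s : A) (k : nat).
(** Values from 2 on keep s^4 - 1, and s^2 t^2 - 1 for two such points, from vanishing. *)
Hypothesis gs : g s = k.+2%:R.

Lemma specialize_neq0 : f s != 0.
Proof. by apply: neq0_fg; rewrite gs pnatr_eq0. Qed.

Lemma sigma_specialize_neq0 : sigma (f s ^+ 2) != 0.
Proof.
have fs0 := specialize_neq0; rewrite sigma_sqrE // mulf_neq0 ?invr_neq0 ?expf_neq0 //.
have := neq0_fg (p := s ^+ 4 - 1); rewrite !(rmorphB, rmorphXn, rmorph1) /= gs; apply.
by rewrite subr_eq0 -natrX (eqr_nat _ _ 1) -[1%N](exp1n 4) eqn_exp2r.
Qed.

End Point.

Variables (s t : A) (k l : nat).
Hypotheses (gs : g s = k.+2%:R) (gt : g t = l.+2%:R).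

Let fs0 : f s != 0 := specialize_neq0 gs.
Let ft0 : f t != 0 := specialize_neq0 gt.

Lemma sqsum_specialize_inj : k != l -> sqsum (f s) != sqsum (f t).
Proof.
move=> kl; rewrite -subr_eq0 sqsumBE //.
rewrite mulf_neq0 ?invr_neq0 ?(mulf_neq0 (expf_neq0 _ fs0) (expf_neq0 _ ft0)) // mulf_neq0 //.
  have := neq0_fg (p := s ^+ 2 - t ^+ 2); rewrite !(rmorphB, rmorphXn) /= gs gt; apply.
  by rewrite subr_eq0 -!natrX eqr_nat eqn_exp2r.
have := neq0_fg (p := s ^+ 2 * t ^+ 2 - 1).
rewrite !(rmorphB, rmorphM, rmorphXn, rmorph1) /= gs gt; apply.
by rewrite subr_eq0 -!natrM (eqr_nat _ _ 1) !muln_eq1.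
Qed.

(** The polynomial numerator is positive at the test point, also for s = t. *)
Lemma sqsumD_specialize_neq0 : sqsum (f s) + sqsum (f t) != 0.
Proof.
rewrite sqsumDE // mulf_neq0 ?invr_neq0 ?(mulf_neq0 (expf_neq0 _ fs0) (expf_neq0 _ ft0)) //.
have := neq0_fg (p := (s ^+ 2 + t ^+ 2) * (1 + s ^+ 2 * t ^+ 2)).
rewrite !(rmorphD, rmorphM, rmorphXn, rmorph1) /= gs gt; apply; apply: lt0r_neq0.
by rewrite !(mulr_gt0, addr_gt0, exprn_gt0, ltr01, ltr0Sn).
Qed.

Lemma UU_den6_specialize_neq0 : UU_den (- 1) (sqsum (f s)) (sqsum (f t)) != 0.
Proof.
rewrite UU_den6E // mulf_neq0 ?invr_neq0 ?(mulf_neq0 (expf_neq0 _ fs0) (expf_neq0 _ ft0)) //.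
have := neq0_fg (p := (s ^+ 4 + s ^+ 2 * t ^+ 2 + t ^+ 4)
                      * (1 + s ^+ 2 * t ^+ 2 + s ^+ 4 * t ^+ 4)).
rewrite !(rmorphD, rmorphM, rmorphXn, rmorph1) /= gs gt; apply; apply: lt0r_neq0.
by rewrite !(mulr_gt0, addr_gt0, exprn_gt0, ltr01, ltr0Sn).
Qed.

Lemma UU_den8_specialize_neq0 : UU_den 0 (sqsum (f s)) (sqsum (f t)) != 0.
Proof.
rewrite UU_den8E // mulf_neq0 ?invr_neq0 ?(mulf_neq0 (expf_neq0 _ fs0) (expf_neq0 _ ft0)) //.
have := neq0_fg (p := (s ^+ 4 + t ^+ 4) * (1 + s ^+ 4 * t ^+ 4)).
rewrite !(rmorphD, rmorphM, rmorphXn, rmorph1) /= gs gt; apply; apply: lt0r_neq0.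
by rewrite !(mulr_gt0, addr_gt0, exprn_gt0, ltr01, ltr0Sn).
Qed.

End Specialization.

(** The roots of unity enter only through polynomial equations, and genericity of the variables only
    through their distinct test values. *)
Lemma A2_VHP_specialize (A : comNzRingType) (K : fieldType) (C : numDomainType)
  (f : {rmorphism A -> K}) (g : {rmorphism A -> C}) (n : nat) (v : 'I_(n + n) -> A)
  (a4 a6 a8 : K) :
  (forall p, g p != 0 -> f p != 0) -> (forall k, g (v k) = k.+2%:R) ->
  a4 ^+ 2 = -1 -> a6 ^+ 2 - a6 + 1 = 0 -> a8 ^+ 4 = -1 -> (0 < n)%N ->
  let x := \row_(i < n) f (v (lshift n i)) in
  let y := \row_(i < n) f (v (rshift n i)) in
  [/\ A2_VHP x y a4 =
        2 ^- (2 * n ^ 2)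
        * (\prod_(i < n) (x 0 i ^- (2 * n) * y 0 i ^- (2 * n)))
        * (\prod_(i < n) \prod_(j < n)
             ((x 0 i ^+ 2 + y 0 j ^+ 2) * (1 + x 0 i ^+ 2 * y 0 j ^+ 2))),
      A2_VHP x y a6 =
        3 ^- (n ^ 2)
        * (\prod_(i < n) (y 0 i ^+ 2 + 1 + y 0 i ^- 2))
        * Spchar (delta_merge 1 (n%:Z - 1) (n%:Z - 1))
            (row_mx (\row_i x 0 i ^+ 2) (\row_i y 0 i ^+ 2))
    & A2_VHP x x a8 =
        2 ^ (- (n%:Z ^+ 2) + n%:Z)
        * GLchar (delta_merge 2 (2 * n%:Z - 2) (2 * n%:Z - 2))
            (row_mx (\row_i x 0 i ^+ 2) (\row_i x 0 i ^- 2)) ].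
Proof.
move=> neq0_fg gv a4E a6E a8E n_gt0 x y.
have xE i : x 0 i = f (v (lshift n i)) by rewrite mxE.
have yE i : y 0 i = f (v (rshift n i)) by rewrite mxE.
have x0 i : x 0 i != 0 by rewrite xE (specialize_neq0 neq0_fg (gv _)).
have y0 i : y 0 i != 0 by rewrite yE (specialize_neq0 neq0_fg (gv _)).
have sx0 i : sigma (x 0 i ^+ 2) != 0.
  by rewrite xE (sigma_specialize_neq0 neq0_fg (gv _)).
have sy0 i : sigma (y 0 i ^+ 2) != 0.
  by rewrite yE (sigma_specialize_neq0 neq0_fg (gv _)).
have v_inj k l : k != l -> sqsum (f (v k)) != sqsum (f (v l)).
  exact: (sqsum_specialize_inj neq0_fg (gv k) (gv l)).
have vD k l : sqsum (f (v k)) + sqsum (f (v l)) != 0.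
  exact: (sqsumD_specialize_neq0 neq0_fg (gv k) (gv l)).
have v6 k l : UU_den (- 1) (sqsum (f (v k))) (sqsum (f (v l))) != 0.
  exact: (UU_den6_specialize_neq0 neq0_fg (gv k) (gv l)).
have v8 k l : UU_den 0 (sqsum (f (v k))) (sqsum (f (v l))) != 0.
  exact: (UU_den8_specialize_neq0 neq0_fg (gv k) (gv l)).
have x_inj i j : i != j -> sqsum (x 0 i) != sqsum (x 0 j).
  by move=> ij; rewrite !xE v_inj // (inj_eq (@lshift_inj _ _)).
have y_inj i j : i != j -> sqsum (y 0 i) != sqsum (y 0 j).
  by move=> ij; rewrite !yE v_inj // (inj_eq (@rshift_inj _ _)).
have natr0 m : (0 < m)%N -> m%:R != 0 :> K :=
  natr_specialize_neq0 neq0_fg (m := m).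
have unit0 (a b : K) m : b != 0 -> a ^+ m.+1 = b -> a != 0.
  by move=> b0 ab; apply: contraNneq b0 => a0; rewrite -ab a0 expr0n.
split.
- apply: A2_VHP_order4; rewrite ?sqsum_order4 ?natr0 //.
    by apply: unit0 a4E; rewrite oppr_eq0 oner_neq0.
  by move=> i j; rewrite xE yE.
- apply: A2_VHP_order6; rewrite ?sqsum_order6 ?natr0 //.
  + by apply: contra_eq_neq a6E => ->; rewrite expr0n subr0 add0r oner_neq0.
  + by move=> i j; rewrite xE yE v_inj // eq_rlshift.
  + by move=> i j _; rewrite !xE.
  + by move=> i j; rewrite xE yE.
apply: A2_VHP_order8; rewrite ?sqsum_order8 ?natr0 //.
- by apply: unit0 a8E; rewrite oppr_eq0 oner_neq0.
- by move=> i j _; rewrite !xE.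
- by move=> i j; rewrite !xE.
Qed.

Unset Implicit Arguments.

Theorem theorem2p3 (R : realType) (n : nat) (n_ge1 : (1 <= n)%N) :
  let x := indet_x R n in
  let y := indet_y R n in
  let z m := ratC n (zeta R m) in
  [/\ A2_VHP x y (z 4%N) =
        2 ^- (2 * n ^ 2)
        * (\prod_(i < n) (x 0 i ^- (2 * n) * y 0 i ^- (2 * n)))
        * (\prod_(i < n) \prod_(j < n)
             ((x 0 i ^+ 2 + y 0 j ^+ 2) * (1 + x 0 i ^+ 2 * y 0 j ^+ 2))),
      A2_VHP x y (z 6%N) =
        3 ^- (n ^ 2)
        * (\prod_(i < n) (y 0 i ^+ 2 + 1 + y 0 i ^- 2))
        * Spchar (delta_merge 1 (n%:Z - 1) (n%:Z - 1))
            (row_mx (\row_i x 0 i ^+ 2) (\row_i y 0 i ^+ 2))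
    & A2_VHP x x (z 8%N) =
        2 ^ (- (n%:Z ^+ 2) + n%:Z)
        * GLchar (delta_merge 2 (2 * n%:Z - 2) (2 * n%:Z - 2))
            (row_mx (\row_i x 0 i ^+ 2) (\row_i x 0 i ^- 2)) ].
Proof.
move=> x y z.
(* The variable with index k, counted from 0, is evaluated at k + 2; a polynomial that is nonzero
   there is nonzero in the fraction field. *)
pose point (k : 'I_(n + n)) : R[i] := k.+2%:R.
pose var (k : 'I_(n + n)) : mpoly (n + n) R[i] := mpolyX R[i] (mnm1 k).
apply: (@A2_VHP_specialize _ (ratfun R n) _ (@tofrac (mpoly (n + n) R[i])) (meval point) n var).
- by move=> p; apply: contraNneq => /eqP; rewrite tofrac_eq0 => /eqP ->; rewrite rmorph0.
- by move=> k; exact: mevalXU.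
- by rewrite /z /ratC -!rmorphXn (@zeta_expr_half R 2) // !rmorphN1.
- rewrite /z /ratC -rmorphXn -rmorphXn -rmorphB -rmorphB -(rmorph1 (@tofrac _)) -rmorphD.
  by rewrite -(rmorph1 (@mpolyC _ _)) -rmorphD zeta6_minpoly !rmorph0.
- by rewrite /z /ratC -!rmorphXn (@zeta_expr_half R 4) // !rmorphN1.
exact: n_ge1.
Qed.
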